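(* Under the Markovian switching setup in the context: (i) If $\beta>\frac{1}{2f_M\pi_{\min}}\big(\frac{\gamma\lambda_G^2}{\lambda_2^3}+\gamma\alpha\big)$, then for all $i\in\{1,\dots,N\}$ and $j\in N_i'$, $$\lim_{t\to\infty}E[(K_2x_i(t)-K_2\bar x(t))^2]=0,\qquad\lim_{t\to\infty}E[(\hat z_{ij}(t)-K_2x_j(t))^2]=0.$$ (ii) If $\gamma>\frac1{\lambda_2}$ and $\beta>\frac{1}{2f_M\pi_{\min}}\big(\frac{\gamma^2\lambda_G^2}{\lambda_2^2(\gamma\lambda_2-1)}+\gamma\alpha+1\big)$, then there is $C>0$ such that for all $i$, $j\in N_i'$, $t\ge t_0+1$, $$E[(K_2x_i(t)-K_2\bar x(t))^2]\le\frac Ct,\qquad E[(\hat z_{ij}(t)-K_2x_j(t))^2]\le\frac Ct.$$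
   Context: Fix integers $n\ge 2$ and $N\ge 2$. Let $a_1,\dots,a_n\in\mathbb{R}$, let $A\in\mathbb{R}^{n\times n}$ be the matrix with $A_{k,k+1}=1$ for $k=1,\dots,n-1$, last row $(a_1,a_2,\dots,a_n)$, and all other entries $0$, and let $B=(0,\dots,0,1)^T\in\mathbb{R}^n$. There are $N$ agents with dynamics $x_i(t+1)=Ax_i(t)+Bu_i(t)$, $i=1,\dots,N$, where $x_i(t)\in\mathbb{R}^n$ and $u_i(t)\in\mathbb{R}$; write $\bar x(t)=\frac1N\sum_{i=1}^N x_i(t)$. Gains: real numbers $b_1,\dots,b_{n-1}$, $K_2=[b_1,\dots,b_{n-1},1]$, $K_1=[-a_1+b_1,\,-a_2+b_2-b_1,\,\dots,\,-a_{n-1}+b_{n-1}-b_{n-2},\,-a_n-b_{n-1}+1]$. Switching topologies: $G_1,\dots,G_h$ are undirected graphs on $\{1,\dots,N\}$ with edge sets $E_1,\dots,E_h$ and Laplacians $L_1,\dots,L_h$; their union $G'$ (edge set $E_1\cup\dots\cup E_h$) is connected. $N_i'$ is the neighbor set of $i$ in $G'$, $d_i'=|N_i'|$, $d'_{\max}=\max_i d_i'$; $N_i^{(u)}$ is the neighbor set of $i$ in $G_u$. $\{m(t)\}$ is a homogeneous Markov chain on $\{1,\dots,h\}$ with irreducible aperiodic transition matrix, stationary distribution $\pi=(\pi_1,\dots,\pi_h)$, $\pi_{\min}=\min_u\pi_u$, independent of the noises. $\check L=\sum_u\pi_uL_u$ has eigenvalues $0=\lambda_1<\lambda_2\le\dots\le\lambda_N$.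 Communication: for every ordered pair $(i,j)$ with $j\in N_i'$ and every $t$, $s_{ij}(t)=1$ if $K_2x_j(t)+d_{ij}(t)\le c_{ij}$ and $0$ otherwise, with fixed thresholds $c_{ij}\in\mathbb R$ and noises $d_{ij}(t)$ i.i.d. $N(0,\sigma^2)$, $\sigma>0$; $F,f$ are the distribution function and density of $N(0,\sigma^2)$. Algorithm: fix $\beta>0$, $\gamma>0$, an integer $t_0>\gamma d'_{\max}-1$, deterministic $x_i(t_0+1)=x_i^0$, $\hat z_{ij}(t_0)=\hat z^0_{ij}$ ($j\in N_i'$), and $M>0$ with $|K_2x_i^0|\le M$, $|\hat z^0_{ij}|\le M$. $\Pi_M(\zeta)=\max\{-M,\min\{M,\zeta\}\}$. For $t\ge t_0+1$, all $i$ and $j\in N_i'$: $\hat z_{ij}(t)=\Pi_M\big(\hat z_{ij}(t-1)+\tfrac{\beta}{t}\mathbb 1\{j\in N_i^{(m(t))}\}(F(c_{ij}-\hat z_{ij}(t-1))-s_{ij}(t))\big)$, $u_i(t)=K_1x_i(t)+\frac{\gamma}{t+1}\sum_{j\in N_i^{(m(t))}}(\hat z_{ij}(t)-K_2x_i(t))$. Constants: enumerate the $d'=\sum_id_i'$ ordered pairs $(i,j)$, $j\in N_i'$, as $p=1,\dots,d'$. $Q\in\mathbb R^{d'\times N}$ with $Q_{p,k}=1$ if pair $p$ has second component $k$, else $0$; $W_u\in\mathbb R^{N\times d'}$ with $(W_u)_{k,p}=1$ if pair $p=(k,j)$ has first component $k$ and $\{k,j\}\in E_u$, else $0$; $J_N=I_N-\frac1N\mathbf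 1\mathbf 1^T$. With spectral norm $\|\cdot\|$: $\lambda_G=\max_u\|J_NW_u\|^2$, $\lambda_{QW}=\max_u\|QW_u\|^2$, $\lambda_{QL}=\max_u\|QL_u\|^2$, $\alpha=2\sqrt{\lambda_{QW}}+\lambda_{QL}\lambda_2/\lambda_G$, $f_M=\min_{(i,j):\,j\in N_i'}f(|c_{ij}|+M)$. *)

(* Defs.v *)
From HB Require Import structures.
From mathcomp Require Import all_boot all_order all_algebra.
From mathcomp Require Import all_classical all_reals all_analysis.
Import Order.TTheory GRing.Theory Num.Theory.



Unset Printing Implicit Defensive.

Local Open Scope classical_set_scope.
Local Open Scope ring_scope.

Section MASDefs.
Context {R : realType}.

(** ** Agent dynamics.  All vectors/matrices are 0-indexed; the scalar
    sequences [a] and [b] are 1-indexed as in the paper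
    ([a 1 .. a n], [b 1 .. b (n-1)]); other values are irrelevant. *)

Definition companionA (n : nat) (a : nat -> R) : 'M[R]_n :=
  \matrix_(r, c) (if (r : nat) == n.-1 then a c.+1
                  else if (c : nat) == r.+1 then 1 else 0).

Definition vecB (n : nat) : 'cV[R]_n :=
  \col_r (if (r : nat) == n.-1 then 1 else 0).

Definition gainK2 (n : nat) (b : nat -> R) : 'rV[R]_n :=
  \row_k (if (k : nat) == n.-1 then 1 else b k.+1).

Definition gainK1 (n : nat) (a b : nat -> R) : 'rV[R]_n :=
  \row_k (let j := (k : nat).+1 in
          if j == 1%N then - a 1%N + b 1%N
          else if j == n then - a n - b n.-1 + 1
          else - a j + b j - b j.-1).

Definition sc {n : nat} (K : 'rV[R]_n) (x : 'cV[R]_n) : R := (K *m x) 0 0.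

(** ** Graphs.  [E u] is the edge relation of G_u on {0..N-1}, u : 'I_h. *)
Definition undirected_simple (N : nat) (e : rel 'I_N) : Prop :=
  (forall i j, e i j = e j i) /\ (forall i, ~~ e i i).

Definition nbr {N h : nat} (E : 'I_h -> rel 'I_N) : rel 'I_N :=
  fun i j => [exists u, E u i j].

Definition deg' {N h : nat} (E : 'I_h -> rel 'I_N) (i : 'I_N) : nat :=
  #|[set j | nbr E i j]|.
Definition dmax' {N h : nat} (E : 'I_h -> rel 'I_N) : nat :=
  \max_(i < N) deg' E i.

Definition lap {N h : nat} (E : 'I_h -> rel 'I_N) (u : 'I_h) : 'M[R]_N :=
  \matrix_(i, j) ((i == j)%:R * (#|[set k | E u i k]|)%:R - (E u i j)%:R).

Definition lapcheck {N h : nat} (E : 'I_h -> rel 'I_N) (pi : 'I_h -> R)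
  : 'M[R]_N := \sum_(u < h) pi u *: lap E u.

(** ** Ordered pairs (i,j) with j \in N_i' : the index set {1,...,d'} *)
Definition pairT {N h : nat} (E : 'I_h -> rel 'I_N) :=
  {p : 'I_N * 'I_N | nbr E p.1 p.2}.

(** Matrices with rows/columns indexed by finite types are represented as
    functions [I -> J -> R]; products are the usual ones. *)
Definition fmul {I J K : finType} (A : I -> J -> R) (B : J -> K -> R)
  : I -> K -> R := fun i k => \sum_(j : J) A i j * B j k.

Definition specnorm {I J : finType} (A : I -> J -> R) : R :=
  sup [set Num.sqrt (\sum_(i : I) (\sum_(j : J) A i j * v j) ^+ 2)
      | v in [set v : J -> R | \sum_(j : J) v j ^+ 2 <= 1]].

Definition Qmat {N h : nat} (E : 'I_h -> rel 'I_N)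
  : pairT E -> 'I_N -> R := fun p k => ((sval p).2 == k)%:R.

Definition Wmat {N h : nat} (E : 'I_h -> rel 'I_N) (u : 'I_h)
  : 'I_N -> pairT E -> R :=
  fun k p => (((sval p).1 == k) && E u k (sval p).2)%:R.

Definition Jmat (N : nat) : 'I_N -> 'I_N -> R :=
  fun i k => (i == k)%:R - N%:R^-1.

Definition Lapf {N h : nat} (E : 'I_h -> rel 'I_N) (u : 'I_h)
  : 'I_N -> 'I_N -> R := fun i j => lap E u i j.

Definition lambdaG {N h : nat} (E : 'I_h -> rel 'I_N) : R :=
  \big[Num.max/0]_(u < h) specnorm (fmul (Jmat N) (Wmat E u)) ^+ 2.
Definition lambdaQW {N h : nat} (E : 'I_h -> rel 'I_N) : R :=
  \big[Num.max/0]_(u < h) specnorm (fmul (Qmat E) (Wmat E u)) ^+ 2.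
Definition lambdaQL {N h : nat} (E : 'I_h -> rel 'I_N) : R :=
  \big[Num.max/0]_(u < h) specnorm (fmul (Qmat E) (Lapf E u)) ^+ 2.

Definition alphaC {N h : nat} (E : 'I_h -> rel 'I_N) (lambda2 : R) : R :=
  2 * Num.sqrt (lambdaQW E) + lambdaQL E * lambda2 / lambdaG E.

Definition Fn (sigma : R) (x : R) : R :=
  fine (normal_prob 0 sigma `]-oo, x]).
Definition fn (sigma : R) (x : R) : R := normal_pdf 0 sigma x.

Definition fM {N h : nat} (E : 'I_h -> rel 'I_N) (sigma M : R)
  (c : 'I_N -> 'I_N -> R) : R :=
  \big[Num.min/fn sigma 0]_(p : 'I_N * 'I_N | nbr E p.1 p.2)
     fn sigma (`|c p.1 p.2| + M).

Definition PiM (M z : R) : R := Num.max (- M) (Num.min M z).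

Definition stochastic {h : nat} (Pm : 'M[R]_h) : Prop :=
  (forall u v, 0 <= Pm u v) /\ (forall u, \sum_(v < h) Pm u v = 1).

Definition irreducible {h : nat} (Pm : 'M[R]_h) : Prop :=
  forall u v, exists k : nat, 0 < (Pm ^+ k) u v.

Definition aperiodic {h : nat} (Pm : 'M[R]_h) : Prop :=
  forall (u : 'I_h) (p : nat), (1 < p)%N ->
    exists k : nat, [/\ (0 < k)%N, 0 < (Pm ^+ k) u u & ~~ (p %| k)%N].

Definition stationary {h : nat} (Pm : 'M[R]_h) (pi : 'I_h -> R) : Prop :=
  [/\ forall u, 0 <= pi u, \sum_(u < h) pi u = 1
    & forall v, \sum_(u < h) pi u * Pm u v = pi v].

Definition pi_min {h : nat} (pi : 'I_h -> R) : R :=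
  \big[Num.min/1]_(u < h) pi u.

Section Prob.
Context {d : measure_display} {T : measurableType d} (P : probability T R).

Definition cyl {h : nat} (m : nat -> T -> 'I_h) (t : nat) (s : nat -> 'I_h)
  : set T := [set w | forall k, (k <= t)%N -> m k w = s k].

(* homogeneous Markov chain with transition matrix Pm (arbitrary initial law) *)
Definition markov_chain {h : nat} (m : nat -> T -> 'I_h) (Pm : 'M[R]_h)
  : Prop :=
  (forall t u, measurable [set w | m t w = u]) /\
  (forall t (s : nat -> 'I_h) (v : 'I_h),
     P (cyl m t s `&` [set w | m t.+1 w = v]) =
     (P (cyl m t s) * (Pm (s t) v)%:E)%E).

Definition mutually_independent {I : eqType} (K : set I)
  (F : I -> set (set T)) : Prop :=
  forall (s : seq I) (A : I -> set T), uniq s ->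
    (forall i, i \in s -> K i /\ F i (A i)) ->
    P (\big[setI/setT]_(i <- s) A i) = (\prod_(i <- s) P (A i))%E.

End Prob.

End MASDefs.

(* Main.v *)
(** With [y_i = K2 x_i] the closed loop is the consensus iteration
    [y_i(t+1) = y_i(t) + gamma/(t+1) * sum_j (zh_ij(t) - y_i(t))], because
    [K2 (A + B K1) = K2] and [K2 B = 1]; it stays in [-M, M].

    Each measurement is one bit, so up to any time the process takes finitely many
    values, and independence gives the probability of a history as the probability of
    the mode path times a product of factors [F(c - y)] or [1 - F(c - y)]. Hence
    [(m(t), y(t+1), zh(t))] is a Markov chain with finite sums as expectations.

    Let [V] be the squared disagreement of [y] and [W] the squared estimation error. The
    drift of [V + q W] contains edge indicators of the current graph. For every edge, a
    solution [psi] of the Poisson equation of the mode chain turns the indicator into its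
    stationary average, once [psi / (t+1)] times the energy of that edge is added to the
    Lyapunov function. With [a = gamma lambda2], [b = gamma lambdaG / lambda2] and
    [d = 2 beta f_M pi_min - gamma alpha], the corrected function decreases at rate
    [kappa / t], up to [O(1/t^2)], as soon as [kappa + q b <= a] and
    [q kappa + b <= q d]. Such a [q] exists with some [kappa > 0] under the hypothesis
    of (i), and with some [kappa > 1] under the hypotheses of (ii). *)

Require Import Defs.
From HB Require Import structures.
From mathcomp Require Import all_boot all_order all_algebra.
From mathcomp Require Import all_classical all_reals all_analysis.
From mathcomp Require Import measurable_realfun ring lra zify.
Import Order.TTheory GRing.Theory Num.Theory.
Local Open Scope classical_set_scope.
Local Open Scope ring_scope.
Set Implicit Arguments.
Unset Strict Implicit.


(** * Cauchy-Schwarz and the spectral norm *)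

(** Cross terms between disagreement and estimation error are bounded by norms uniform over the
    graphs, so the mode survives only in edge sums of definite sign. These cannot be bounded graph
    by graph: a single [G_u] may be disconnected, and an absent edge leaves its estimate
    uncorrected. Their stationary averages are coercive, with constants [2 gamma lambda2] for [V]
    and [2 beta f_M pi_min] for [W]. Young's inequality spends half of the first constant on a cross
    term; this leaves [a] and creates [b]. For [kappa] below [a] and [d], the two weight
    inequalities admit some [q] iff b^2 <= (a - kappa)(d - kappa). The thresholds on [beta] are the
    strict form of this condition at [kappa = 0] and [kappa = 1]. The value 1 matters because w(t+1)
    <= (1 - kappa/(t+1)) w(t) + C/(t+1)^2 yields the rate 1/t once [kappa > 1], while for smaller
    positive [kappa] the divergence of the harmonic series still yields convergence. The Markov
    state joins y(t+1) to zh(t), so the error zh(t) - y(t) is one step off from the terms of [W]; it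
    is recovered at a cost O(1/t^2) in the mean square. *)

Lemma twice_le_add_of_sqr_le (F : realFieldType) (x a b : F) :
  0 <= a -> 0 <= b -> x ^+ 2 <= a * b -> 2 * x <= a + b.
Proof.
move=> a0 b0 xab; rewrite leNgt; apply/negP => lt.
have : (a + b) ^+ 2 < (2 * x) ^+ 2.
  by rewrite ltr_pXn2r// nnegrE ?addr_ge0// (le_trans _ (ltW lt))// addr_ge0.
apply/negP; rewrite -leNgt; have := sqr_ge0 (a - b); lra.
Qed.

Lemma cauchy_schwarz_sum (F : realFieldType) (I : finType) (a b : I -> F) :
  (\sum_i a i * b i) ^+ 2 <= (\sum_i a i ^+ 2) * (\sum_i b i ^+ 2).
Proof.
set A := \sum_i a i ^+ 2; set B := \sum_i b i ^+ 2; set X := \sum_i a i * b i.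
have B0 : 0 <= B by apply: sumr_ge0 => i _; exact: sqr_ge0.
have [B_eq0|B_neq0] := eqVneq B 0.
  have b0 i : b i = 0.
    apply/eqP; rewrite -sqrf_eq0; apply/eqP.
    by apply: (psumr_eq0P _ B_eq0) => // j _; exact: sqr_ge0.
  by rewrite /X big1 ?B_eq0 ?mulr0 ?expr0n//= => i _; rewrite b0 mulr0.
have Bgt0 : 0 < B by rewrite lt_neqAle eq_sym B_neq0.
have : 0 <= \sum_i (B * a i - X * b i) ^+ 2 by apply: sumr_ge0 => i _; exact: sqr_ge0.
have -> : \sum_i (B * a i - X * b i) ^+ 2 = B * (A * B - X ^+ 2).
  rewrite (eq_bigr (fun i => B ^+ 2 * a i ^+ 2 + (- (2 * B * X)) * (a i * b i)
                             + X ^+ 2 * b i ^+ 2)); last by move=> i _; ring.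
  by rewrite !big_split/= -!mulr_sumr -/A -/B -/X; ring.
by rewrite pmulr_rge0// subr_ge0.
Qed.

Section SpectralNorm.
Context {R : realType} {I J : finType}.
Implicit Types (A : I -> J -> R) (v : J -> R).

(** The Frobenius norm is a bound. Without one, [sup] would be a default value and [specnorm] would
    control nothing. *)
Lemma specnorm_has_ubound A :
  has_ubound [set Num.sqrt (\sum_(i : I) (\sum_(j : J) A i j * v j) ^+ 2)
      | v in [set v : J -> R | \sum_(j : J) v j ^+ 2 <= 1]].
Proof.
exists (Num.sqrt (\sum_i \sum_j A i j ^+ 2)) => _ [v /= v1 <-].
rewrite ler_sqrt; last by do 2 (apply: sumr_ge0 => ? _); exact: sqr_ge0.
apply: ler_sum => i _; apply: (le_trans (cauchy_schwarz_sum _ _)).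
by rewrite ler_piMr//; apply: sumr_ge0 => j _; exact: sqr_ge0.
Qed.

Lemma specnorm_bound A v :
  \sum_i (\sum_j A i j * v j) ^+ 2 <= specnorm A ^+ 2 * \sum_j v j ^+ 2.
Proof.
set s := \sum_j v j ^+ 2.
have s0 : 0 <= s by apply: sumr_ge0 => j _; exact: sqr_ge0.
have [s_eq0|s_neq0] := eqVneq s 0.
  have v0 j : v j = 0.
    apply/eqP; rewrite -sqrf_eq0; apply/eqP.
    by apply: (psumr_eq0P _ s_eq0) => // k _; exact: sqr_ge0.
  rewrite s_eq0 mulr0 big1// => i _; rewrite big1 ?expr0n//= => j _.
  by rewrite v0 mulr0.
have sgt0 : 0 < s by rewrite lt_neqAle eq_sym s_neq0.
set r := Num.sqrt s.
have r2 : r ^+ 2 = s by rewrite sqr_sqrtr.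
have rgt0 : 0 < r by rewrite sqrtr_gt0.
set V := \sum_i (\sum_j A i j * (v j / r)) ^+ 2.
have V0 : 0 <= V by apply: sumr_ge0 => j _; exact: sqr_ge0.
have -> : \sum_i (\sum_j A i j * v j) ^+ 2 = V * s.
  rewrite /V mulr_suml -r2; apply: eq_bigr => i _; rewrite -exprMn; congr (_ ^+ _).
  by rewrite mulr_suml; apply: eq_bigr => j _; rewrite mulrA divfK ?gt_eqF.
rewrite ler_pM2r// -(sqr_sqrtr V0) ler_pXn2r ?nnegrE ?sqrtr_ge0//.
  apply: ub_le_sup; first exact: specnorm_has_ubound.
  exists (fun j => v j / r) => //=.
  under eq_bigr do rewrite exprMn.
  by rewrite -mulr_suml -/s exprVn r2 divff.
(* Remaining side condition: [specnorm A] is nonnegative, by the same element of the set. *)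
apply: (@le_trans _ _ (Num.sqrt V)); first exact: sqrtr_ge0.
apply: ub_le_sup; first exact: specnorm_has_ubound.
exists (fun j => v j / r) => //=.
under eq_bigr do rewrite exprMn.
by rewrite -mulr_suml -/s exprVn r2 divff.
Qed.

Lemma specnorm_bilinear A v (w : I -> R) :
  (\sum_i w i * \sum_j A i j * v j) ^+ 2 <=
  (\sum_i w i ^+ 2) * (specnorm A ^+ 2 * \sum_j v j ^+ 2).
Proof.
apply: (le_trans (cauchy_schwarz_sum _ _)); apply: ler_wpM2l.
  by apply: sumr_ge0 => i _; exact: sqr_ge0.
exact: specnorm_bound.
Qed.

(** Test on a basis vector. It serves to make [lambdaG] positive from one nonzero entry. *)
Lemma specnorm_entry A i j : A i j ^+ 2 <= specnorm A ^+ 2.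
Proof.
have := specnorm_bound A (fun k => (k == j)%:R).
rewrite [X in _ * X](_ : _ = 1); last first.
  rewrite (bigD1 j)//= eqxx expr1n big1 ?addr0// => k /negbTE ->.
  by rewrite expr0n.
rewrite mulr1; apply: le_trans.
have Aij k : \sum_l A k l * (l == j)%:R = A k j.
  by rewrite (bigD1 j)//= eqxx mulr1 big1 ?addr0// => l /negbTE ->; rewrite mulr0.
rewrite (bigD1 i)//= Aij lerDl.
by apply: sumr_ge0 => k _; exact: sqr_ge0.
Qed.

End SpectralNorm.

(** * The Poisson equation of a finite chain *)

Section PoissonEquation.
Context {R : realType} {h : nat} (Pm : 'M[R]_h) (pi : 'I_h -> R).
Hypotheses (stoch : stochastic Pm) (irr : irreducible Pm) (stat : stationary Pm pi).

Lemma stochastic_pow k : stochastic (Pm ^+ k).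
Proof.
elim: k => [|k [IH0 IH1]].
  rewrite expr0; split => [u v|u]; first by rewrite !mxE ler0n.
  rewrite (bigD1 u)//= !mxE eqxx big1 ?addr0// => v /negbTE vu.
  by rewrite !mxE eq_sym vu.
rewrite exprS; case: stoch => s0 s1; split => [u v|u].
  by rewrite !mxE; apply: sumr_ge0 => w _; exact: mulr_ge0.
under eq_bigr do rewrite !mxE.
rewrite exchange_big/= -(s1 u); apply: eq_bigr => w _.
by rewrite -mulr_sumr IH1 mulr1.
Qed.

Lemma stationary_pow k v : \sum_u pi u * (Pm ^+ k) u v = pi v.
Proof.
elim: k v => [|k IH] v.
  rewrite expr0 (bigD1 v)//= mxE eqxx mulr1 big1 ?addr0// => u /negbTE uv.
  by rewrite mxE uv mulr0.
rewrite exprSr; under eq_bigr do rewrite !mxE mulr_sumr.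
rewrite exchange_big/=; case: stat => _ _ <-; apply: eq_bigr => w _.
by rewrite -[in RHS]IH mulr_suml; apply: eq_bigr => u _; rewrite mulrA.
Qed.

(** Some state carries mass, and by irreducibility a power of [Pm], which also preserves [pi], moves
    part of that mass to [v]. *)
Lemma stationary_gt0 v : 0 < pi v.
Proof.
case: (stat) => pi0 pi1 _; have [k] : exists u, pi u != 0.
  apply: contrapT => /forallNP H; move: pi1; rewrite big1; last first.
    by move=> u _; have /negP := H u; rewrite negbK => /eqP.
  by move/eqP; rewrite eq_sym oner_eq0.
move=> pik; have [j Pj] := irr k v; rewrite -(stationary_pow j v) (bigD1 k)//=.
apply: ltr_pwDl; first by rewrite mulr_gt0// lt_neqAle eq_sym pik pi0.
apply: sumr_ge0 => u _; apply: mulr_ge0 => //.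
by case: (stochastic_pow j).
Qed.

(** Maximum principle: at a maximiser [mx], the nonnegative gaps [v mx 0 - v j 0] average to 0 under
    every power of [Pm], and each state is reached with positive weight by some power. *)
Lemma harmonic_constant (v : 'cV[R]_h) : Pm *m v = v -> forall u w, v u 0 = v w 0.
Proof.
move=> Pv.
have Pvk k : (Pm ^+ k) *m v = v.
  by elim: k => [|k IH]; rewrite ?expr0 ?mul1mx// exprS -mulmxA IH.
move=> u0 w0.
pose mx := [arg max_(i > u0) v i 0]%O; have mxP w : v w 0 <= v mx 0.
  by rewrite /mx; case: arg_maxP => //= i _; apply.
suff H u : v u 0 = v mx 0 by rewrite !H.
have [k Pk] := irr mx u.
have := congr1 (fun A : 'cV_h => A mx 0) (Pvk k); rewrite mxE => E.
have [s0 s1] := stochastic_pow k.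
have S0 : \sum_j (Pm ^+ k) mx j * (v mx 0 - v j 0) = 0.
  by under eq_bigr do rewrite mulrBr; rewrite sumrB E -mulr_suml s1 mul1r subrr.
have /eqP : (Pm ^+ k) mx u * (v mx 0 - v u 0) = 0.
  by apply: (psumr_eq0P _ S0) => // j _; rewrite mulr_ge0// subr_ge0.
by rewrite mulf_eq0 (gt_eqF Pk)/= subr_eq0 eq_sym => /eqP.
Qed.

(** [B] is the fundamental matrix I - P + 1 pi of the chain. Since [pr *m B = pr], a kernel vector
    of [B] has [pi]-mean 0, hence is harmonic, hence constant, hence 0. The same identity gives
    [g = invmx B *m fc] mean 0, so the rank-one term drops out of [B *m g]. *)
Lemma poisson_solution (f : 'I_h -> R) : \sum_u pi u * f u = 0 ->
  exists g : 'I_h -> R, forall u, g u - \sum_v Pm u v * g v = f u.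
Proof.
move=> pif0; case: (stat) => pi0 pi1 piP; case: (stoch) => s0 s1.
pose pr : 'rV[R]_h := \row_u pi u; pose one : 'cV[R]_h := const_mx 1.
pose B := 1%:M - Pm + one *m pr.
have prP : pr *m Pm = pr.
  by apply/rowP => v; rewrite !mxE -[RHS]piP; apply: eq_bigr => u _; rewrite mxE.
have pr1 : pr *m one = 1%:M.
  apply/matrixP => i j; rewrite !ord1 !mxE eqxx -[RHS]pi1; apply: eq_bigr => u _.
  by rewrite !mxE mulr1.
have prB : pr *m B = pr.
  by rewrite /B mulmxDr mulmxBr mulmx1 prP subrr add0r mulmxA pr1 mul1mx.
have uB : B \in unitmx.
  rewrite -unitmx_tr -row_free_unit -kermx_eq0; apply/eqP/row_matrixP => k.
  rewrite row0; pose v := (row k (kermx B^T))^T.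
  have Bv : B *m v = 0.
    by apply: trmx_inj; rewrite trmx_mul trmxK trmx0 -row_mul mulmx_ker row0.
  have prv : pr *m v = 0 by rewrite -prB -mulmxA Bv mulmx0.
  have Pv : Pm *m v = v.
    move: Bv; rewrite /B mulmxDl mulmxBl mul1mx -mulmxA prv mulmx0 addr0.
    by move/eqP; rewrite subr_eq0 => /eqP.
  have vc := harmonic_constant Pv.
  apply: trmx_inj; rewrite -/v trmx0; apply/colP => u; rewrite [RHS]mxE.
  have prv0 : \sum_w pr 0 w * v w 0 = 0.
    by have := congr1 (fun A : 'M[R]_(1, 1) => A 0 0) prv; rewrite mxE [RHS]mxE.
  rewrite -prv0.
  rewrite -[LHS]mul1r -pi1 mulr_suml; apply: eq_bigr => w _.
  by rewrite [pr _ _]mxE (vc u w).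
pose fc : 'cV[R]_h := \col_u f u; pose g := invmx B *m fc.
have Bg : B *m g = fc by rewrite /g mulKVmx.
have prg : pr *m g = 0.
  rewrite -prB -mulmxA Bg; apply/matrixP => i j; rewrite !ord1 !mxE -[RHS]pif0.
  by apply: eq_bigr => u _; rewrite !mxE.
exists (fun u => g u 0) => u.
have : (B *m g) u 0 = f u by rewrite Bg mxE.
rewrite /B mulmxDl mulmxBl mul1mx -mulmxA prg mulmx0 addr0 => <-.
by rewrite [RHS]mxE [X in _ = _ + X]mxE [X in _ = _ - X]mxE.
Qed.

End PoissonEquation.

(** * Spectral gap of a Laplacian *)

Section SpectralGap.
Context {R : realType}.

Definition dotc {n} (u v : 'cV[R]_n) : R := \sum_i u i 0 * v i 0.

Lemma dotcC n (u v : 'cV[R]_n) : dotc u v = dotc v u.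
Proof. by apply: eq_bigr => i _; rewrite mulrC. Qed.

Lemma dotcDr n (u v w : 'cV[R]_n) : dotc u (v + w) = dotc u v + dotc u w.
Proof. by rewrite -big_split/=; apply: eq_bigr => i _; rewrite mxE mulrDr. Qed.

Lemma dotcZr n (u v : 'cV[R]_n) k : dotc u (k *: v) = k * dotc u v.
Proof. by rewrite mulr_sumr; apply: eq_bigr => i _; rewrite mxE mulrCA. Qed.

Lemma dotcDl n (u v w : 'cV[R]_n) : dotc (v + w) u = dotc v u + dotc w u.
Proof. by rewrite dotcC dotcDr !(dotcC u). Qed.

Lemma dotcZl n (u v : 'cV[R]_n) k : dotc (k *: v) u = k * dotc v u.
Proof. by rewrite dotcC dotcZr dotcC. Qed.

Lemma dotc_mulmx n (A : 'M[R]_n) (u v : 'cV[R]_n) :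
  dotc u (A *m v) = dotc (A^T *m u) v.
Proof.
rewrite /dotc; under eq_bigr do rewrite mxE mulr_sumr.
rewrite exchange_big/=; apply: eq_bigr => j _; rewrite mxE mulr_suml.
by apply: eq_bigr => i _; rewrite mxE; ring.
Qed.

Lemma dotc_ge0 n (v : 'cV[R]_n) : 0 <= dotc v v.
Proof. by apply: sumr_ge0 => i _; rewrite -expr2 sqr_ge0. Qed.

Lemma dotc_eq0 n (v : 'cV[R]_n) : dotc v v = 0 -> v = 0.
Proof.
move=> v0; apply/colP => i; rewrite mxE; apply/eqP; rewrite -sqrf_eq0; apply/eqP.
have : v i 0 * v i 0 = 0.
  by apply: (psumr_eq0P _ v0) => // j _; rewrite -expr2 sqr_ge0.
by rewrite expr2.
Qed.

Lemma dotc_gt0 n (v : 'cV[R]_n) : v != 0 -> 0 < dotc v v.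
Proof.
move=> v0; rewrite lt_neqAle dotc_ge0 andbT eq_sym.
by apply: contra v0 => /eqP/dotc_eq0 ->.
Qed.

Lemma dotc_mulmx_le n (A : 'M[R]_n) : exists2 K, 0 < K &
  forall v : 'cV[R]_n, dotc (A *m v) (A *m v) <= K * dotc v v.
Proof.
(* Squared Frobenius norm; the 1 keeps the constant positive when [A] is 0. *)
exists (1 + \sum_i \sum_j A i j ^+ 2).
  by rewrite ltr_pwDl//; do 2 (apply: sumr_ge0 => ? _); exact: sqr_ge0.
move=> v; rewrite mulrDl mul1r; apply: (@le_trans _ _ (0 + _)); last first.
  by apply: lerD; [exact: dotc_ge0|exact: lexx].
rewrite add0r mulr_suml; apply: ler_sum => i _; rewrite -expr2 mxE.
apply: (le_trans (cauchy_schwarz_sum _ _)).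
by rewrite /dotc; under [X in _ <= _ * X]eq_bigr do rewrite -expr2.
Qed.

(* Expanding the form at x - B x / K, where K dominates B, yields <x, B x> >= |B x|^2 / K. *)
Lemma psd_unit_coercive n (B : 'M[R]_n) : B^T = B ->
  (forall v : 'cV[R]_n, 0 <= dotc v (B *m v)) -> B \in unitmx ->
  exists2 c, 0 < c & forall v : 'cV[R]_n, c * dotc v v <= dotc v (B *m v).
Proof.
move=> symB psdB uB.
have [K1 K1gt0 BK1] := dotc_mulmx_le B.
have [K2 K2gt0 BK2] := dotc_mulmx_le (invmx B).
pose K := 1 + K1; have Kgt0 : 0 < K by rewrite /K; lra.
have formK (v : 'cV[R]_n) : dotc v (B *m v) <= K * dotc v v.
  have : 2 * dotc v (B *m v) <= dotc v v + dotc (B *m v) (B *m v).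
    have := dotc_ge0 (v + (-1) *: (B *m v)).
    rewrite !(dotcDr, dotcDl, dotcZl, dotcZr) (dotcC (B *m v) v); lra.
  by have := BK1 v; have := dotc_ge0 v; have := psdB v; rewrite /K; nra.
exists (K^-1 * K2^-1); first by rewrite mulr_gt0 ?invr_gt0.
move=> v; set w := B *m v.
have wv : dotc w w <= K * dotc v w.
  have := psdB (v + (- K^-1) *: w).
  rewrite mulmxDr -scalemxAr -/w !(dotcDr, dotcDl, dotcZl, dotcZr).
  have -> : dotc v (B *m w) = dotc w w by rewrite dotc_mulmx symB.
  have := formK w; set p := dotc w (B *m w); set q := dotc w w.
  move=> pq H.
  have : 0 <= K * (dotc v w + - K^-1 * q + (- K^-1 * q + - K^-1 * (- K^-1 * p))).
    by rewrite mulr_ge0// ltW.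
  have -> : K * (dotc v w + - K^-1 * q + (- K^-1 * q + - K^-1 * (- K^-1 * p))) =
     K * dotc v w - 2 * q + K^-1 * p by field; rewrite gt_eqF.
  have : K^-1 * p <= q by rewrite mulrC ler_pdivrMr// mulrC.
  lra.
have vw : dotc v v <= K2 * dotc w w by rewrite -[v in X in X <= _](mulKmx uB) BK2.
by rewrite -mulrA ler_pdivrMl// ler_pdivrMl//; apply: (le_trans vw); rewrite ler_pM2l.
Qed.

(** [mu] is the infimum of the Rayleigh quotient on the complement of [one], and attainment is
    obtained algebraically. The shifted matrix [B] is positive semidefinite; were it invertible,
    [psd_unit_coercive] would make [mu + c] a lower bound of the quotient as well. So [B] has a
    kernel vector, which is the eigenvector sought. *)
Lemma symmetric_rayleigh_min n (A : 'M[R]_n.+2) (one := const_mx 1 : 'cV[R]_n.+2) :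
  A^T = A -> A *m one = 0 ->
  (forall v : 'cV[R]_n.+2, 0 <= dotc v (A *m v)) ->
  exists mu (v : 'cV[R]_n.+2), [/\ A *m v = mu *: v, v != 0, dotc one v = 0 &
    forall w : 'cV[R]_n.+2, dotc one w = 0 -> mu * dotc w w <= dotc w (A *m w)].
Proof.
move=> symA A1 psdA.
pose S := [set dotc v (A *m v) / dotc v v
          | v in [set v : 'cV[R]_n.+2 | v != 0 /\ dotc one v = 0]].
have lbS : lbound S 0.
  by move=> _ [v [v0 _] <-]; rewrite divr_ge0 ?dotc_ge0.
have S0 : S !=set0.
  pose v : 'cV[R]_n.+2 := delta_mx 0 0 - delta_mx 1 0.
  eexists; exists v; last by reflexivity.
  split.
    apply/eqP => /colP /(_ 0); rewrite !mxE/= subr0 => /eqP.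
    by rewrite oner_eq0.
  rewrite /dotc 2!big_ord_recl !mxE/= big1 => [|i _]; rewrite ?mxE/=.
    by rewrite subr0 sub0r mul1r addr0 mul1r subrr.
  by rewrite subrr mulr0.
have infS : has_inf S by split => //; exists 0.
have [mu muE] : exists mu, mu = inf S by exists (inf S).
have mu0 : 0 <= mu by rewrite muE; apply: lb_le_inf.
have muP (w : 'cV[R]_n.+2) : dotc one w = 0 -> mu * dotc w w <= dotc w (A *m w).
  move=> w1; have [->|w0] := eqVneq w 0.
    by rewrite /dotc !big1 ?mulr0// => i _; rewrite mxE ?mul0r.
  rewrite -ler_pdivlMr ?dotc_gt0// muE; apply: ge_inf; first by case: infS.
  by exists w.
have one1 : dotc one one = n.+2%:R.
  rewrite /dotc; under eq_bigr do rewrite !mxE mulr1.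
  by rewrite sumr_const card_ord.
have n2 : 1 <= n.+2%:R :> R by rewrite ler1n.
(* On the complement of [one] this is [A - mu]. On [one] itself the eigenvalue is
   [(mu + 1) * n.+2%:R - mu], which is positive, so the rank-one term repairs positivity there and
   forces kernel vectors to be orthogonal to [one]. *)
pose B := A - mu%:M + (mu + 1) *: (one *m one^T).
have BE (v : 'cV[R]_n.+2) : B *m v = A *m v + (- mu) *: v + ((mu + 1) * dotc one v) *: one.
  rewrite /B mulmxDl mulmxBl mul_scalar_mx scaleNr; congr (_ + _).
  rewrite -scalemxAl -mulmxA -scalerA; congr (_ *: _); apply/colP => i.
  rewrite !mxE big_ord1 !mxE mul1r mulr1 /dotc.
  by apply: eq_bigr => j _; rewrite !mxE.
have symB : B^T = B.
  rewrite /B linearD linearB/= tr_scalar_mx symA linearZ/=; congr (_ + _ *: _).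
  by rewrite trmx_mul trmxK.
have oneA (v : 'cV[R]_n.+2) : dotc one (A *m v) = 0.
  by rewrite dotc_mulmx symA A1 /dotc big1// => i _; rewrite mxE mul0r.
have psdB (v : 'cV[R]_n.+2) : 0 <= dotc v (B *m v).
  have [w [k [w1 ->]]] : exists (w : 'cV[R]_n.+2) k, dotc one w = 0 /\ v = w + k *: one.
    exists (v + (- (dotc one v / n.+2%:R)) *: one), (dotc one v / n.+2%:R).
    by split; [rewrite dotcDr dotcZr one1; field|rewrite scaleNr subrK].
  have Av : A *m (w + k *: one) = A *m w by rewrite mulmxDr -scalemxAr A1 scaler0 addr0.
  rewrite BE Av !(dotcDr, dotcDl, dotcZl, dotcZr) oneA (dotcC w one) w1 one1.
  have := muP _ w1.
  set q := dotc w (A *m w); set nn := n.+2%:R in n2 *; set ww := dotc w w => mq.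
  rewrite [X in 0 <= X](_ : _ =
    (q - mu * ww) + k ^+ 2 * nn * (mu * (nn - 1) + nn)); last by ring.
  have k2 := sqr_ge0 k.
  have nn0 : 0 <= nn by exact: le_trans n2.
  have nn1 : 0 <= nn - 1 by rewrite subr_ge0.
  apply: addr_ge0; first by rewrite subr_ge0.
  by apply: mulr_ge0; [exact: mulr_ge0|apply: addr_ge0 => //; exact: mulr_ge0].
have : B \notin unitmx.
  apply/negP => uB; have [c c0 cP] := psd_unit_coercive symB psdB uB.
  have : mu + c <= mu; last by lra.
  rewrite [X in _ <= X]muE; apply: lb_le_inf => // _ [v [v0 v1] <-].
  rewrite ler_pdivlMr ?dotc_gt0//.
  by have := cP v; rewrite BE v1 mulr0 scale0r addr0 dotcDr dotcZr; lra.
rewrite -unitmx_tr -row_free_unit -kermx_eq0 => /matrix0Pn [i [j ij]].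
pose v := (row i (kermx B^T))^T.
have Bv : B *m v = 0.
  by apply: trmx_inj; rewrite trmx_mul trmxK trmx0 -row_mul mulmx_ker row0.
have v1 : dotc one v = 0.
  have := congr1 (dotc one) Bv; rewrite BE !(dotcDr, dotcZr) oneA one1.
  rewrite [RHS]big1; last by move=> k _; rewrite [X in _ * X]mxE mulr0.
  move=> H; have /eqP : ((mu + 1) * n.+2%:R - mu) * dotc one v = 0.
    by rewrite -[RHS]H; ring.
  rewrite mulf_eq0 => /orP[/eqP E|/eqP//].
  have : 0 <= (mu + 1) * (n.+2%:R - 1) by rewrite mulr_ge0//; lra.
  lra.
exists mu, v; split => //.
  move: Bv; rewrite BE v1 mulr0 scale0r addr0 scaleNr => /eqP.
  by rewrite subr_eq0 => /eqP.
apply/eqP => v0; move: ij; have := congr1 (fun A : 'cV_ _ => A j 0) v0.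
by rewrite !mxE => ->; rewrite eqxx.
Qed.

(* Adding all columns to the first one factors 'X out of the characteristic polynomial. *)
Lemma char_poly_simple_zero n (A : 'M[R]_n.+1) (one := const_mx 1 : 'cV[R]_n.+1) :
  A^T = A -> A *m one = 0 ->
  (forall v : 'cV[R]_n.+1, A *m v = 0 -> forall i j, v i 0 = v j 0) ->
  exists2 q : {poly R}, char_poly A = 'X * q & q.[0] != 0.
Proof.
move=> symA A1 kerA.
pose M' : 'M[{poly R}]_n.+1 :=
  \matrix_(i, j) (if j == 0 then 1 else char_poly_mx A i j).
pose U : 'M[{poly R}]_n.+1 := \matrix_(i, j) (if j == 0 then 1 else (i == j)%:R).
pose D : 'rV[{poly R}]_n.+1 := \row_j (if j == 0 then 'X else 1).
have sumA i : \sum_j A i j = 0.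
  have : (A *m one) i 0 = 0 by rewrite A1 mxE.
  by rewrite mxE => {2}<-; apply: eq_bigr => j _; rewrite mxE mulr1.
have E : char_poly_mx A *m U = M' *m diag_mx D.
  apply/matrixP => i j; rewrite mul_mx_diag !mxE; have [->|j0] := eqVneq j 0.
    rewrite mul1r; under eq_bigr do rewrite [X in _ * X]mxE eqxx mulr1 !mxE.
    rewrite sumrB -[X in _ - X]/(\sum_j (A i j)%:P) -rmorph_sum/= sumA subr0.
    by rewrite (bigD1 i)//= eqxx big1 ?addr0// => k; rewrite eq_sym => /negbTE ->.
  rewrite mulr1; under eq_bigr do rewrite [X in _ * X]mxE (negbTE j0).
  by rewrite (bigD1 j)//= eqxx mulr1 big1 ?addr0 ?mxE// => k /negbTE ->; rewrite mulr0.
have detU : \det U = 1.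
  rewrite det_trig; first by apply: big1 => i _; rewrite mxE eqxx if_same.
  apply/is_trig_mxP => i j ij; rewrite mxE.
  have -> : (j == 0) = false.
    by apply/negbTE; rewrite -val_eqE/=; rewrite -lt0n (leq_ltn_trans _ ij).
  by have -> : (i == j) = false by apply/negbTE; rewrite -val_eqE/= ltn_eqF.
have detD : \det (diag_mx D) = 'X.
  by rewrite det_diag big_ord_recl mxE/= big1 ?mulr1// => i _; rewrite mxE.
exists (\det M').
  by have := congr1 determinant E; rewrite !det_mulmx detU mulr1 detD mulrC.
rewrite -horner_evalE -det_map_mx.
set C := map_mx _ M'; apply/negP => detC.
have CE i j : C i j = if j == 0 then 1 else - A i j.
  rewrite !mxE; case: ifP => _; first by rewrite rmorph1.
  by rewrite /= /horner_eval; case: (i == j); rewrite ?mulr1n ?mulr0n !hornerE.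
have : C^T \notin unitmx by rewrite unitmx_tr unitmxE unitfE negbK.
rewrite -row_free_unit -kermx_eq0 => /matrix0Pn [i0 [j0 ij]].
pose v := (row i0 (kermx C^T))^T.
have Cv : C *m v = 0.
  by apply: trmx_inj; rewrite trmx_mul trmxK trmx0 -row_mul mulmx_ker row0.
suff v0 : v = 0.
  move: ij; have := congr1 (fun A : 'cV_ _ => A j0 0) v0.
  by rewrite !mxE => ->; rewrite eqxx.
(* [C *m v = 0] says that [A *m w] is the constant vector of value [v 0 0]. Pairing with [one] gives
   [v 0 0 = 0]; then [w] lies in the kernel of [A], so it is constant, and its entry at 0
   vanishes. *)
pose w : 'cV[R]_n.+1 := \col_j (if j == 0 then 0 else v j 0).
have CvE i : v 0 0 - (A *m w) i 0 = 0.
  have := congr1 (fun A : 'cV_ _ => A i 0) Cv; rewrite mxE [RHS]mxE => <-.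
  rewrite (bigD1 0)//= CE eqxx mul1r; congr (_ + _).
  rewrite mxE (bigD1 0)//= [w 0 0]mxE eqxx mulr0 add0r -sumrN; apply: eq_bigr => j j1.
  by rewrite CE mxE (negbTE j1) mulNr.
have v00 : v 0 0 = 0.
  have : \sum_i (v 0 0 - (A *m w) i 0) = 0 by apply: big1 => i _; exact: CvE.
  rewrite sumrB sumr_const card_ord.
  have -> : \sum_i (A *m w) i 0 = dotc one (A *m w).
    by apply: eq_bigr => i _; rewrite [one _ _]mxE mul1r.
  rewrite dotc_mulmx symA A1 /dotc big1; last by move=> i _; rewrite mxE mul0r.
  by rewrite subr0 => /eqP; rewrite mulrn_eq0 => /eqP.
have Aw : A *m w = 0.
  apply/colP => i; have := CvE i; rewrite v00 sub0r => /eqP.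
  by rewrite oppr_eq0 => /eqP ->; rewrite mxE.
apply/colP => j; rewrite [RHS]mxE; have [->//|j1] := eqVneq j 0.
have := kerA _ Aw j 0; rewrite [w j 0]mxE [w 0 0]mxE (negbTE j1) eqxx.
by [].
Qed.

(** If [lam 2] were 0 like [lam 1], then 0 would be a multiple root of the characteristic
    polynomial. For the gap, the Rayleigh minimum on the complement of [one] is some [lam k]; the
    case [k = 1] would give a constant eigenvector orthogonal to [one], so [k] is at least 2. *)
Lemma second_eigenvalue_gap n (A : 'M[R]_n.+2) (one := const_mx 1 : 'cV[R]_n.+2)
    (lam : nat -> R) :
  A^T = A -> A *m one = 0 ->
  (forall v : 'cV[R]_n.+2, 0 <= dotc v (A *m v)) ->
  (forall v : 'cV[R]_n.+2, dotc v (A *m v) = 0 -> forall i j, v i 0 = v j 0) ->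
  (forall k l, (1 <= k)%N -> (k <= l)%N -> (l <= n.+2)%N -> lam k <= lam l) ->
  char_poly A = \prod_(1 <= k < n.+3) ('X - (lam k)%:P) ->
  0 < lam 2%N /\
  (forall w : 'cV[R]_n.+2, dotc one w = 0 -> lam 2%N * dotc w w <= dotc w (A *m w)).
Proof.
move=> symA A1 psdA kerA sorted_lam charA.
have oneN0 : one != 0.
  by apply/eqP => /colP /(_ 0); rewrite !mxE => /eqP; rewrite oner_eq0.
have eigen (v : 'cV[R]_n.+2) mu : v != 0 -> A *m v = mu *: v ->
    exists k, [/\ (1 <= k)%N, (k <= n.+2)%N & mu = lam k].
  move=> v0 Av; have : root (char_poly A) mu.
    rewrite -eigenvalue_root_char; apply/eigenvalueP; exists v^T.
      by rewrite -[in LHS]symA -trmx_mul Av linearZ.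
    by rewrite trmx_eq0.
  rewrite charA /root horner_prod prodf_seq_eq0 => /hasP[k].
  rewrite mem_index_iota => /andP[k1 k2] /=; rewrite !hornerE subr_eq0 => /eqP mk.
  by exists k; split.
have lam_ge0 k : (1 <= k)%N -> (k <= n.+2)%N -> 0 <= lam k.
  move=> k1 k2; have : root (char_poly A) (lam k).
    rewrite charA /root horner_prod prodf_seq_eq0; apply/hasP; exists k.
      by rewrite mem_index_iota k1.
    by rewrite /= !hornerE subrr.
  rewrite -eigenvalue_root_char => /eigenvalueP [v vA v0].
  have : A *m v^T = lam k *: v^T by rewrite -[in LHS]symA -trmx_mul vA linearZ.
  move=> Av; have := psdA v^T; rewrite Av dotcZr pmulr_lge0// dotc_gt0//.
  by rewrite trmx_eq0.
have lam1 : lam 1%N = 0.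
  apply/eqP; rewrite eq_le lam_ge0// andbT.
  have [|k [k1 k2 ->]] := @eigen one 0 oneN0; first by rewrite A1 scale0r.
  exact: sorted_lam.
have lam2 : 0 < lam 2%N.
  rewrite lt_neqAle lam_ge0// andbT; apply/eqP => l2.
  have [|q charq q0] := char_poly_simple_zero symA A1.
    by move=> v Av; apply: kerA; rewrite Av /dotc big1// => i _; rewrite mxE mulr0.
  move: charA; rewrite charq big_ltn// big_ltn// lam1 -l2 subr0.
  move/(mulfI (negbT (polyX_eq0 R))) => qE.
  by move: q0; rewrite qE hornerM hornerX mul0r eqxx.
split=> // w w1.
have [mu [v [Av v0 v1 muP]]] := symmetric_rayleigh_min symA A1 psdA.
apply: le_trans (muP _ w1); apply: ler_wpM2r; first exact: dotc_ge0.
have [k [k1 k2 mk]] := eigen _ _ v0 Av; rewrite mk.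
have [k_gt1|] := ltnP 1 k; first exact: sorted_lam.
move=> k_le1; have k_eq1 : k = 1%N by apply/eqP; rewrite eqn_leq k_le1.
have vv : dotc v (A *m v) = 0.
  by rewrite Av mk k_eq1 lam1 scale0r /dotc big1// => i _; rewrite mxE mulr0.
have vc := kerA _ vv; exfalso; move/eqP: v0; apply; apply/colP => i.
rewrite [RHS]mxE; move: v1; rewrite /dotc.
under eq_bigr => j _ do rewrite mxE mul1r (vc j i).
by rewrite sumr_const card_ord => /eqP; rewrite mulrn_eq0 => /eqP.
Qed.

End SpectralGap.

(** * Edge sums, graph Laplacians and the gap of the averaged Laplacian *)

Lemma card_mkset (T : finType) (P : pred T) : #|[set x | P x]%classic| = #|P|.
Proof. by apply: eq_card => x; apply/idP/idP; rewrite inE. Qed.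

Section Graphs.
Context {R : realType} {N h : nat} (E : 'I_h -> rel 'I_N).

Definition edge (u : 'I_h) (p : pairT E) : R := (E u (val p).1 (val p).2)%:R.

Lemma edge_ge0 u p : 0 <= edge u p. Proof. exact: ler0n. Qed.

Lemma edge_le1 u p : edge u p <= 1. Proof. by rewrite /edge lern1 leq_b1. Qed.

Lemma pairT_edge (p : pairT E) : exists u, edge u p = 1.
Proof. by have /existsP[u pu] := valP p; exists u; rewrite /edge pu. Qed.

Lemma sum_pairT (G : 'I_N -> 'I_N -> R) :
  \sum_(p : pairT E) G (val p).1 (val p).2 = \sum_i \sum_j (nbr E i j)%:R * G i j.
Proof.
rewrite pair_bigA/= (bigID (fun p => nbr E p.1 p.2))/= [X in _ = _ + X]big1 ?addr0.
  rewrite (eq_bigr (fun p => G p.1 p.2)); last by move=> p ->; rewrite mul1r.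
  exact/esym/(big_sub (fun p : 'I_N * 'I_N => nbr E p.1 p.2) (fun p => G p.1 p.2)).
by move=> p /negbTE ->; rewrite mul0r.
Qed.

Lemma sum_edge u (G : 'I_N -> 'I_N -> R) :
  \sum_p edge u p * G (val p).1 (val p).2 = \sum_i \sum_j (E u i j)%:R * G i j.
Proof.
rewrite (sum_pairT (fun i j => (E u i j)%:R * G i j)).
apply: eq_bigr => i _; apply: eq_bigr => j _; rewrite mulrA; congr (_ * _).
case Eij : (E u i j); last by rewrite mulr0.
by have -> : nbr E i j; rewrite ?mulr1//; apply/existsP; exists u.
Qed.

Lemma sum_Wmat u i (G : 'I_N -> R) :
  \sum_(p : pairT E) Wmat E u i p * G (val p).2 = \sum_(j | E u i j) G j.
Proof.
transitivity (\sum_p edge u p * ((i == (val p).1)%:R * G (val p).2)).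
  apply: eq_bigr => p _; rewrite /Wmat /edge eq_sym.
  by case: eqP => [->|_]; rewrite /= ?mul1r// !mul0r mulr0.
rewrite (sum_edge u (fun k j => (i == k)%:R * G j)) (bigD1 i)//= [X in _ + X]big1 ?addr0.
  rewrite [RHS]big_mkcond; apply: eq_bigr => j _; rewrite eqxx mul1r.
  by case: (E u i j); rewrite ?mul1r ?mul0r.
by move=> k; rewrite eq_sym => /negbTE ik; apply: big1 => j _; rewrite ik mul0r mulr0.
Qed.

Lemma lap_apply u (y : 'I_N -> R) i :
  \sum_j lap E u i j * y j = \sum_(j | E u i j) (y i - y j).
Proof.
under eq_bigr do rewrite mxE mulrBl.
rewrite sumrB (bigD1 i)//= eqxx mul1r [X in _ + X - _]big1 ?addr0; last first.
  by move=> j; rewrite eq_sym => /negbTE ->; rewrite !mul0r.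
rewrite sumrB; congr (_ - _).
  by rewrite sumr_const mulr_natl card_mkset.
rewrite [RHS]big_mkcond; apply: eq_bigr => j _.
by case: (E u i j); rewrite ?mul1r ?mul0r.
Qed.

Hypothesis simpleE : forall u, undirected_simple N (E u).

(** The factor 2 is there because [pairT E] contains both orientations of every edge. *)
Lemma lap_form u (y : 'I_N -> R) :
  2 * \sum_i y i * \sum_j lap E u i j * y j =
  \sum_p edge u p * (y (val p).1 - y (val p).2) ^+ 2.
Proof.
rewrite (sum_edge u (fun i j => (y i - y j) ^+ 2)).
have X : \sum_i y i * (\sum_j lap E u i j * y j) =
    \sum_i \sum_j (E u i j)%:R * (y i * (y i - y j)).
  apply: eq_bigr => i _; rewrite lap_apply mulr_sumr big_mkcond/=; apply: eq_bigr => j _.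
  by case: (E u i j); rewrite ?mul1r ?mul0r.
have X' : \sum_i y i * (\sum_j lap E u i j * y j) =
    \sum_i \sum_j (E u i j)%:R * (y j * (y j - y i)).
  rewrite X exchange_big/=; apply: eq_bigr => i _; apply: eq_bigr => j _.
  by case: (simpleE u) => ->.
rewrite mulr_natl mulr2n {1}X X' -big_split/=; apply: eq_bigr => i _.
by rewrite -big_split/=; apply: eq_bigr => j _; ring.
Qed.

Lemma lap_sym u : (lap E u)^T = lap E u :> 'M[R]_N.
Proof.
apply/matrixP => i j; rewrite !mxE eq_sym; case: (simpleE u) => -> _.
by case: eqP => [->|_] //; rewrite !mul0r.
Qed.

Lemma lap_one u i : \sum_j lap E u i j = 0 :> R.
Proof.
have := lap_apply u (fun=> 1) i; under eq_bigr do rewrite mulr1.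
by move=> ->; rewrite big1// => j _; rewrite subrr.
Qed.

Context (pi : 'I_h -> R).
Hypothesis (pi_gt0 : forall u, 0 < pi u).

Definition avg_edge (p : pairT E) : R := \sum_u pi u * edge u p.

Lemma pi_min_gt0 : 0 < pi_min pi.
Proof. by rewrite /pi_min; elim/big_ind : _ => // x y x0 y0; rewrite lt_min x0. Qed.

(** Each pair of the union graph is an edge of at least one [G_u]; this is the origin of [pi_min] in
    the threshold. *)
Lemma avg_edge_ge p : pi_min pi <= avg_edge p.
Proof.
have [u pu] := pairT_edge p; rewrite /avg_edge (bigD1 u)//= pu mulr1.
apply: (@le_trans _ _ (pi u)); first exact: bigmin_le_cond.
by rewrite lerDl; apply: sumr_ge0 => v _; rewrite mulr_ge0 ?edge_ge0 ?ltW.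
Qed.

Lemma lapcheck_form (v : 'cV[R]_N) :
  2 * dotc v (lapcheck E pi *m v) =
  \sum_p avg_edge p * (v (val p).1 0 - v (val p).2 0) ^+ 2.
Proof.
rewrite /lapcheck mulmx_suml.
have -> : dotc v (\sum_u pi u *: lap E u *m v) =
    \sum_u pi u * \sum_i v i 0 * \sum_j lap E u i j * v j 0.
  rewrite /dotc; under eq_bigr do rewrite summxE mulr_sumr.
  rewrite exchange_big/=; apply: eq_bigr => u _; rewrite mulr_sumr.
  apply: eq_bigr => i _; rewrite -scalemxAl !mxE; ring.
rewrite mulr_sumr.
under eq_bigr => u _ do rewrite mulrCA (lap_form u (fun i => v i 0)) mulr_sumr.
rewrite exchange_big/=; apply: eq_bigr => p _; rewrite mulr_suml.
by apply: eq_bigr => u _; rewrite mulrA.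
Qed.

(** All averages [avg_edge] are positive, so a vector on which the form vanishes is constant along
    union edges, and constant by connectivity. This is the kernel condition of
    [second_eigenvalue_gap]. *)
Lemma laplacian_gap (lam : nat -> R) :
  (2 <= N)%N ->
  (forall i j, connect (nbr E) i j) ->
  (forall k l, (1 <= k)%N -> (k <= l)%N -> (l <= N)%N -> lam k <= lam l) ->
  char_poly (lapcheck E pi) = \prod_(1 <= k < N.+1) ('X - (lam k)%:P) ->
  0 < lam 2%N /\ forall y : 'I_N -> R, \sum_i y i = 0 ->
    2 * (lam 2%N * \sum_i y i ^+ 2) <=
    \sum_p avg_edge p * (y (val p).1 - y (val p).2) ^+ 2.
Proof.
move=> N2 conn sorted_lam charL.
have symL : (lapcheck E pi)^T = lapcheck E pi.
  by rewrite /lapcheck linear_sum; apply: eq_bigr => u _; rewrite linearZ/= lap_sym.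
have oneL : lapcheck E pi *m (const_mx 1 : 'cV[R]_N) = 0.
  apply/colP => i; rewrite /lapcheck mulmx_suml summxE [RHS]mxE big1// => u _.
  rewrite -scalemxAl !mxE; under eq_bigr do rewrite [const_mx _ _ _]mxE mulr1.
  by rewrite lap_one mulr0.
have avg_gt0 p : 0 < avg_edge p by apply: lt_le_trans (avg_edge_ge p); exact: pi_min_gt0.
have psdL (v : 'cV[R]_N) : 0 <= dotc v (lapcheck E pi *m v).
  rewrite -(@pmulr_rge0 _ 2)// lapcheck_form; apply: sumr_ge0 => p _.
  by rewrite mulr_ge0 ?sqr_ge0// ltW.
have kerL (v : 'cV[R]_N) : dotc v (lapcheck E pi *m v) = 0 -> forall i j, v i 0 = v j 0.
  move=> v0; have vE i j : nbr E i j -> v i 0 = v j 0.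
    move=> ij; have := lapcheck_form v; rewrite v0 mulr0 => /esym S0.
    have /eqP : avg_edge (exist _ (i, j) ij : pairT E) * (v i 0 - v j 0) ^+ 2 = 0.
      by apply: (psumr_eq0P _ S0) => // p _; rewrite mulr_ge0 ?sqr_ge0// ltW.
    by rewrite mulf_eq0 gt_eqF//= sqrf_eq0 subr_eq0 => /eqP.
  move=> i j; have /connectP[s] := conn i j.
  elim: s i => [|k s IH] i /=; first by move=> _ ->.
  by move=> /andP[ik ks] lst; rewrite (vE _ _ ik) (IH k ks lst).
have gap : 0 < lam 2%N /\ (forall w : 'cV[R]_N, dotc (const_mx 1) w = 0 ->
    lam 2%N * dotc w w <= dotc w (lapcheck E pi *m w)).
  move: (lapcheck E pi) symL oneL psdL kerL charL sorted_lam N2.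
  clear; case: N => [|[|n]] // A symA A1 psdA kerA charA sorted_lam _.
  exact: second_eigenvalue_gap symA A1 psdA kerA sorted_lam charA.
case: gap => lam2 gap; split=> // y y0.
have := gap (\col_i y i); have := lapcheck_form (\col_i y i).
under [in RHS]eq_bigr do rewrite !mxE.
move=> <- H; rewrite ler_pM2l//; apply: le_trans (H _).
  by rewrite /dotc; under [X in _ <= _ * X]eq_bigr do rewrite !mxE -expr2.
by rewrite /dotc -[RHS]y0; apply: eq_bigr => i _; rewrite !mxE mul1r.
Qed.

Lemma specnorm_JW_le u : specnorm (fmul (@Jmat R N) (Wmat E u)) ^+ 2 <= lambdaG E.
Proof. exact: (le_bigmax _ (fun u => specnorm (fmul (@Jmat R N) (Wmat E u)) ^+ 2)). Qed.

Lemma specnorm_QW_le u : specnorm (fmul (@Qmat R N h E) (Wmat E u)) ^+ 2 <= lambdaQW E.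
Proof. exact: (le_bigmax _ (fun u => specnorm (fmul (@Qmat R N h E) (Wmat E u)) ^+ 2)). Qed.

Lemma specnorm_QL_le u : specnorm (fmul (@Qmat R N h E) (Lapf E u)) ^+ 2 <= lambdaQL E.
Proof. exact: (le_bigmax _ (fun u => specnorm (fmul (@Qmat R N h E) (Lapf E u)) ^+ 2)). Qed.

(** For an edge (i,j) of [G_u], the entry of [J_N W_u] in row i and column (i,j) is 1 - 1/N. *)
Lemma lambdaG_gt0 (p : pairT E) : (2 <= N)%N -> 0 < lambdaG E :> R.
Proof.
move=> N2; have [u pu] := pairT_edge p; apply: lt_le_trans (specnorm_JW_le u).
apply: lt_le_trans (specnorm_entry _ (val p).1 p).
rewrite exprn_even_gt0//= /fmul (bigD1 (val p).1)//= big1 ?addr0; last first.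
  by move=> j; rewrite /Wmat eq_sym => /negbTE ->; rewrite mulr0.
have Ep : E u (val p).1 (val p).2.
  by move/eqP: pu; rewrite /edge; case: (E u _ _) => //; rewrite eq_sym oner_eq0.
rewrite /Wmat/= eqxx Ep mulr1 /Jmat eqxx subr_eq0 eq_sym invr_eq1.
by rewrite (eqr_nat R N 1); case: N N2 => [|[|]].
Qed.

End Graphs.

(** * The normal distribution function *)

Section NormalCdf.
Context {R : realType} (sigma : R).
Hypothesis sigma_gt0 : 0 < sigma.

Let Nprob : probability _ R := normal_prob 0 sigma.

Lemma Fn_EFin x : (Fn sigma x)%:E = normal_prob 0 sigma `]-oo, x].
Proof.
rewrite /Fn fineK//; apply: (@fin_num_measure _ _ _ Nprob).
exact: measurable_itv.
Qed.

Lemma Fn_ge0 x : 0 <= Fn sigma x.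
Proof. by rewrite -lee_fin Fn_EFin; exact: (@measure_ge0 _ _ _ Nprob). Qed.

Lemma Fn_le1 x : Fn sigma x <= 1.
Proof.
by rewrite -lee_fin Fn_EFin; apply: (@probability_le1 _ _ _ Nprob); exact: measurable_itv.
Qed.

Lemma fn_gt0 x : 0 < fn sigma x.
Proof.
rewrite /fn normal_pdfE ?gt_eqF// mulr_gt0 ?expR_gt0//.
by apply: normal_peak_gt0; rewrite gt_eqF.
Qed.

Lemma fn_le x y : `|x| <= `|y| -> fn sigma y <= fn sigma x.
Proof.
move=> xy; rewrite /fn normal_pdfE ?gt_eqF//; apply: ler_wpM2l; first exact: normal_peak_ge0.
rewrite /normal_fun ler_expR !subr0 ler_pM2r; last by rewrite invr_gt0 pmulrn_lgt0// exprn_gt0.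
by rewrite lerN2 -(real_normK (num_real x)) -(real_normK (num_real y)) ler_pXn2r ?nnegrE.
Qed.

(** The difference is the mass of the interval from [x] to [y], and the density is at least [k]
    there. *)
Lemma Fn_sub_ge (k x y : R) : x <= y ->
  (forall z, x <= z <= y -> k <= fn sigma z) -> 0 <= k ->
  k * (y - x) <= Fn sigma y - Fn sigma x.
Proof.
move=> xy kf k0.
have mI : measurable `]x, y]%classic by exact: measurable_itv.
have split_itv : `]-oo, y]%classic = `]-oo, x]%classic `|` `]x, y]%classic.
  by rewrite -itv_bndbnd_setU// bnd_simp.
have disj : `]-oo, x]%classic `&` `]x, y]%classic = set0.
  rewrite -subset0 => z [] /=; rewrite !in_itv/= => zx /andP[xz _].
  by move: (lt_le_trans xz zx); rewrite ltxx.
rewrite -lee_fin EFinB !Fn_EFin split_itv (@measureU _ _ _ Nprob)//.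
have fin1 : Nprob `]-oo, x]%classic \is a fin_num.
  by apply: fin_num_measure; exact: measurable_itv.
rewrite addeAC subee// add0e.
apply: (@le_trans _ _ (\int[lebesgue_measure]_(z in `]x, y]) (cst k%:E z))%E).
  rewrite integral_cst//= lebesgue_measure_itv/= lte_fin.
  case: ltP => [_|yx]; first by rewrite -EFinB EFinM.
  by rewrite mule0 lee_fin mulr_ge0_le0// subr_le0.
rewrite /Nprob/= /normal_prob; apply: ge0_le_integral => //=.
- apply/measurable_EFinP; apply: measurable_funTS; exact: measurable_normal_pdf.
- move=> z; rewrite in_itv/= => /andP[xz zy]; rewrite lee_fin; apply: kf.
  by rewrite (ltW xz).
Qed.

End NormalCdf.

Section DensityBound.
Context {R : realType} {N h : nat} (E : 'I_h -> rel 'I_N) (sigma M : R).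
Context (c : 'I_N -> 'I_N -> R).
Hypotheses (sigma_gt0 : 0 < sigma).

Lemma fM_gt0 : 0 < fM E sigma M c.
Proof.
rewrite /fM; elim/big_ind : _ => [|x y x0 y0|p _]; [exact: fn_gt0| |exact: fn_gt0].
by rewrite lt_min x0.
Qed.

Lemma fM_le (p : pairT E) : fM E sigma M c <= fn sigma (`|c (val p).1 (val p).2| + M).
Proof.
apply: (bigmin_le_cond _ (fun p : 'I_N * 'I_N => fn sigma (`|c p.1 p.2| + M))).
exact: (valP p).
Qed.

(** Strong monotonicity of the one-bit observation on the box: the segment between [c - y] and
    [c - z] stays within distance [|c| + M] of 0, where the density, which decreases in the absolute
    value, is at least [fM]. *)
Lemma Fn_monotone_bound (p : pairT E) (y z : R) : `|y| <= M -> `|z| <= M ->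
  (z - y) * (Fn sigma (c (val p).1 (val p).2 - z) - Fn sigma (c (val p).1 (val p).2 - y))
  <= - (fM E sigma M c * (z - y) ^+ 2).
Proof.
set k := c _ _.
have main y1 z1 : `|y1| <= M -> `|z1| <= M -> y1 <= z1 ->
    fM E sigma M c * (z1 - y1) <= Fn sigma (k - y1) - Fn sigma (k - z1).
  move=> y1M z1M yz; rewrite (_ : z1 - y1 = (k - y1) - (k - z1)); last by ring.
  apply: Fn_sub_ge => //; [lra| |exact/ltW/fM_gt0].
  move=> x /andP[x1 x2]; apply: (le_trans (fM_le p)); apply: fn_le => //.
  apply: le_trans (ler_norm _).
  move: y1M z1M; rewrite !ler_norml => /andP[a1 a2] /andP[b1 b2]; rewrite -/k.
  by have := ler_norm k; have := ler_norm (- k); rewrite normrN => *; apply/andP; split; lra.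
move=> yM zM; have [yz|/ltW zy] := leP y z.
  have := main _ _ yM zM yz; have : 0 <= z - y by lra.
  set F1 := Fn _ _; set F2 := Fn _ _; move: (fM _ _ _ _) => f A B.
  have : 0 <= (z - y) * (F1 - F2 - f * (z - y)) by rewrite mulr_ge0//; lra.
  lra.
have := main _ _ zM yM zy; have : 0 <= y - z by lra.
set F1 := Fn _ _; set F2 := Fn _ _; move: (fM _ _ _ _) => f A B.
have : 0 <= (y - z) * (F1 - F2 - f * (y - z)) by rewrite mulr_ge0//; lra.
lra.
Qed.

End DensityBound.

(** * One step of the algorithm *)

Section CrossTerms.
Context {R : realType} {N h : nat} (E : 'I_h -> rel 'I_N) (lam2 : R).
Hypothesis lam2_gt0 : 0 < lam2.
Implicit Types (d : 'I_N -> R) (e : pairT E -> R) (u : 'I_h).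

Let sumsq_ge0 (I : finType) (f : I -> R) : 0 <= \sum_i f i ^+ 2.
Proof. by apply: sumr_ge0 => i _; exact: sqr_ge0. Qed.

Lemma fmul_Qmat (J : finType) (A : 'I_N -> J -> R) (p : pairT E) j :
  fmul (Qmat E) A p j = A (val p).2 j.
Proof.
rewrite /fmul (bigD1 (val p).2)//= {1}/Qmat eqxx mul1r big1 ?addr0// => k.
by rewrite eq_sym /Qmat => /negbTE; rewrite /sval/= => ->; rewrite mul0r.
Qed.

(** Because [d] sums to 0, [J_N] can be inserted in front of [W_u], and the norm bounded by
    [lambdaG] appears. The Young weights are [lam2] and [lambdaG E / lam2], so that [d] uses up
    exactly half of the coercivity [2 lam2] of the averaged Laplacian. *)
Lemma cross_delta_W u d e : 0 < lambdaG E :> R -> \sum_i d i = 0 ->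
  2 * \sum_i d i * \sum_p Wmat E u i p * e p <=
  lam2 * \sum_i d i ^+ 2 + lambdaG E / lam2 * \sum_p e p ^+ 2.
Proof.
move=> lG d0.
have -> : \sum_i d i * (\sum_p Wmat E u i p * e p) =
    \sum_i d i * \sum_p fmul (@Jmat R N) (Wmat E u) i p * e p.
  have JW i p : fmul (@Jmat R N) (Wmat E u) i p =
      Wmat E u i p - N%:R^-1 * \sum_k Wmat E u k p.
    rewrite /fmul /Jmat; under eq_bigr do rewrite mulrBl.
    rewrite sumrB -mulr_sumr (bigD1 i)//= eqxx mul1r [X in _ + X - _]big1 ?addr0//.
    by move=> k; rewrite eq_sym => /negbTE ->; rewrite mul0r.
  under [RHS]eq_bigr do under eq_bigr do rewrite JW mulrBl.
  under [RHS]eq_bigr do rewrite sumrB mulrBr.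
  by rewrite sumrB -[X in _ - X]mulr_suml d0 mul0r subr0.
apply: twice_le_add_of_sqr_le.
- by rewrite mulr_ge0// ltW.
- by rewrite mulr_ge0// divr_ge0// ltW.
apply: (le_trans (specnorm_bilinear _ _ _)).
rewrite (_ : lam2 * _ * _ = (\sum_i d i ^+ 2) * (lambdaG E * \sum_p e p ^+ 2)).
  by rewrite ler_wpM2l// ler_wpM2r// specnorm_JW_le.
by field; rewrite gt_eqF.
Qed.

(** Source of the first summand of [alphaC]. *)
Lemma cross_eps_QW u e :
  - (2 * \sum_p e p * \sum_q Wmat E u (val p).2 q * e q) <=
  2 * Num.sqrt (lambdaQW E) * \sum_p e p ^+ 2.
Proof.
rewrite -mulrN; set s := \sum_p e p ^+ 2.
have -> : 2 * Num.sqrt (lambdaQW E) * s =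
  Num.sqrt (lambdaQW E) * s + Num.sqrt (lambdaQW E) * s by ring.
have s0 : 0 <= s by exact: sumsq_ge0.
have rs0 : 0 <= Num.sqrt (lambdaQW E) * s by rewrite mulr_ge0 ?sqrtr_ge0.
apply: twice_le_add_of_sqr_le => //.
have -> : Num.sqrt (lambdaQW E) * s * (Num.sqrt (lambdaQW E) * s) = s * (lambdaQW E * s).
  rewrite (_ : _ * _ = Num.sqrt (lambdaQW E) ^+ 2 * s * s); last by ring.
  rewrite sqr_sqrtr; first by ring.
  by rewrite /lambdaQW bigmax_ge_id.
rewrite sqrrN.
under eq_bigr => p _ do under eq_bigr => q _ do rewrite -(fmul_Qmat (Wmat E u)).
apply: (le_trans (specnorm_bilinear _ _ _)).
by rewrite ler_wpM2l// ler_wpM2r// specnorm_QW_le.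
Qed.

(** Source of the second summand of [alphaC]. The two Young weights multiply to [lambdaQL E], and
    they are split so that the disagreement gets the same coefficient [lambdaG E / lam2] as the
    estimation error in [cross_delta_W]. *)
Lemma cross_eps_QL u d e : 0 < lambdaG E :> R ->
  2 * \sum_p e p * \sum_j lap E u (val p).2 j * d j <=
  lambdaQL E * lam2 / lambdaG E * \sum_p e p ^+ 2 +
  lambdaG E / lam2 * \sum_i d i ^+ 2.
Proof.
move=> lG; have lQL0 : 0 <= lambdaQL E :> R by rewrite /lambdaQL bigmax_ge_id.
apply: twice_le_add_of_sqr_le.
- by rewrite mulr_ge0// divr_ge0 ?mulr_ge0// ltW.
- by rewrite mulr_ge0// divr_ge0// ltW.
under eq_bigr => p _ do under eq_bigr => q _ do rewrite -[lap _ _ _ _](fmul_Qmat (Lapf E u)).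
apply: (le_trans (specnorm_bilinear _ _ _)).
rewrite (_ : lambdaQL E * _ / _ * _ * _ =
  (\sum_p e p ^+ 2) * (lambdaQL E * \sum_i d i ^+ 2)).
  by rewrite ler_wpM2l// ler_wpM2r// specnorm_QL_le.
by field; rewrite !gt_eqF.
Qed.

End CrossTerms.

Lemma norm_sum_le (R : realType) (I : finType) (f : I -> R) B :
  (forall i, `|f i| <= B) -> `|\sum_i f i| <= #|I|%:R * B.
Proof.
move=> fB; apply: (le_trans (ler_norm_sum _ _ _)).
apply: (le_trans (ler_sum _ (fun i _ => fB i))).
by rewrite sumr_const mulr_natl.
Qed.

Lemma PiM_norm (R : realType) (M x : R) : 0 < M -> `|PiM M x| <= M.
Proof.
move=> M0; rewrite ler_norml /PiM le_max lexx /= ge_max ge_min lexx /= andbT; lra.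
Qed.

Lemma PiM_dist (R : realType) (M x a : R) : 0 < M -> `|a| <= M ->
  `|PiM M x - a| <= `|x - a|.
Proof.
move=> M0; rewrite ler_norml => /andP[aM1 aM2]; rewrite /PiM.
have [xM|Mx] := leP M x.
  rewrite max_r; last lra.
  by rewrite !ger0_norm ?subr_ge0//; [lra|apply: le_trans xM].
have [xM|xM] := leP (- M) x; first by [].
by rewrite !ler0_norm ?subr_le0//; [lra|apply: le_trans aM1; exact: ltW].
Qed.

Section UpdateStep.
Context {R : realType} {N h : nat} (E : 'I_h -> rel 'I_N).
Context (c : 'I_N -> 'I_N -> R) (sigma M beta gamma : R).
Hypotheses (M_gt0 : 0 < M).
Hypotheses (beta_gt0 : 0 < beta) (gamma_gt0 : 0 < gamma).

Local Notation bits := {ffun pairT E -> bool}.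
Implicit Types (y : 'I_N -> R) (z : pairT E -> R) (u : 'I_h) (s : bits).

Definition thr (p : pairT E) : R := c (val p).1 (val p).2.

Definition upd_z t u s z : pairT E -> R := fun p =>
  PiM M (z p + beta / t%:R * edge u p * (Fn sigma (thr p - z p) - (s p)%:R)).

(** The state before step [t] is y(t) together with zh(t-1); the estimate refreshed at time [t] is
    what drives [y]. *)
Definition upd_y t u s y z : 'I_N -> R := fun i =>
  y i + gamma / t.+1%:R * \sum_p Wmat E u i p * (upd_z t u s z p - y i).

Definition mean y : R := N%:R^-1 * \sum_i y i.
Definition dev y : 'I_N -> R := fun i => y i - mean y.
(** On the state this is zh(t-1) - y(t), not zh(t) - y(t); the shift is undone in
    [mean_square_bounds]. *)
Definition eps y z : pairT E -> R := fun p => z p - y (val p).2.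
Definition disagr y : R := \sum_i dev y i ^+ 2.
Definition esterr y z : R := \sum_p eps y z p ^+ 2.
Definition drift u y z : 'I_N -> R := fun i => \sum_p Wmat E u i p * (z p - y i).

Definition in_box y z := (forall i, `|y i| <= M) /\ (forall p, `|z p| <= M).

Let nb : R := #|{: pairT E}|%:R.
Let nb_ge0 : 0 <= nb. Proof. exact: ler0n. Qed.

Lemma Wmat_le1 u i p : 0 <= (Wmat E u i p : R) <= 1.
Proof. by rewrite /Wmat ler0n lern1 leq_b1. Qed.

Lemma diff_norm_le (a b : R) : `|a| <= M -> `|b| <= M -> `|a - b| <= 2 * M.
Proof. by move=> aM bM; apply: (le_trans (ler_normB _ _)); lra. Qed.

Lemma upd_z_norm t u s z p : `|upd_z t u s z p| <= M.
Proof. exact: PiM_norm. Qed.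

Lemma Fn_sub_bit x (b : bool) : `|Fn sigma x - b%:R| <= 1.
Proof.
have F0 := Fn_ge0 sigma x; have F1 := Fn_le1 sigma x.
by case: b; rewrite ler_norml; apply/andP; split; rewrite /=; lra.
Qed.

Lemma upd_z_raw t u s z p : (0 < t)%N ->
  `|beta / t%:R * edge u p * (Fn sigma (thr p - z p) - (s p)%:R)| <= beta / t%:R.
Proof.
move=> t0; have bt : 0 <= beta / t%:R by rewrite divr_ge0 ?ler0n// ltW.
rewrite -mulrA normrM (ger0_norm bt) ler_piMr// normrM (ger0_norm (edge_ge0 _ _)).
by rewrite mulr_ile1 ?edge_ge0 ?edge_le1 ?Fn_sub_bit.
Qed.

Lemma upd_z_close t u s y z p : (0 < t)%N -> in_box y z ->
  `|upd_z t u s z p - z p| <= beta / t%:R.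
Proof.
move=> t0 [_ zM]; apply: (le_trans (PiM_dist _ M_gt0 (zM p))).
rewrite addrAC subrr add0r; exact: upd_z_raw.
Qed.

(** The target [y] lies in the box, so the projection can only reduce the distance. The middle term
    stays linear in the bit [s p], ready to be averaged over the noise. *)
Lemma upd_z_sqr t u s y z p : (0 < t)%N -> in_box y z ->
  (upd_z t u s z p - y (val p).2) ^+ 2 <=
  eps y z p ^+ 2 +
  2 * beta / t%:R * (edge u p * eps y z p * (Fn sigma (thr p - z p) - (s p)%:R)) +
  beta ^+ 2 / t%:R ^+ 2.
Proof.
move=> t0 [yM zM]; have := PiM_dist (z p +
   beta / t%:R * edge u p * (Fn sigma (thr p - z p) - (s p)%:R)) M_gt0 (yM (val p).2).
rewrite -/(upd_z t u s z p) => H.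
have H2 := ler_pM (normr_ge0 _) (normr_ge0 _) H H.
move: H2; rewrite -!normrM -!expr2 !ger0_norm ?sqr_ge0// => H2.
apply: (le_trans H2).
have := upd_z_raw u s z p t0.
set r := beta / t%:R * edge u p * _ => r1.
have r2 : r ^+ 2 <= (beta / t%:R) ^+ 2.
  rewrite -(real_normK (num_real r)) ler_pXn2r ?nnegrE//.
  by rewrite divr_ge0 ?ler0n// ltW.
rewrite (_ : z p + r - _ = eps y z p + r); last by rewrite /eps; ring.
move: r2; rewrite [X in _ <= X]exprMn exprVn => r2.
have -> : 2 * beta / t%:R * (edge u p * eps y z p * (Fn sigma (thr p - z p) - (s p)%:R))
  = 2 * eps y z p * r by rewrite /r; ring.
rewrite sqrrD -mulr_natl mulrA; lra.
Qed.

Lemma upd_y_close : exists2 C, 0 <= C & forall t u s y z i, (0 < t)%N -> in_box y z ->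
  `|upd_y t u s y z i - y i| <= C / t%:R.
Proof.
exists (gamma * (nb * (2 * M))); first by rewrite !mulr_ge0// ltW.
move=> t u s y z i t0 [yM zM]; rewrite /upd_y addrAC subrr add0r normrM.
rewrite gtr0_norm ?divr_gt0 ?ltr0n//.
have : `|\sum_p Wmat E u i p * (upd_z t u s z p - y i)| <= nb * (2 * M).
  apply: norm_sum_le => p; rewrite normrM.
  have /andP[W0 W1] := Wmat_le1 u i p; rewrite ger0_norm//.
  apply: (@le_trans _ _ (1 * (2 * M))); last by rewrite mul1r.
  by apply: ler_pM => //; apply: diff_norm_le => //; exact: upd_z_norm.
move=> S; rewrite [X in _ <= X]mulrAC; apply: ler_pM => //; first by rewrite divr_ge0// ltW.
by rewrite ler_pM2l// lef_pV2 ?posrE ?ltr0n// ler_nat.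
Qed.

(** Two replacements, [gamma / t.+1] by [gamma / t] and the new estimate by the old one, each cost
    O(1/t^2) on the box. *)
Lemma upd_y_linear : exists2 C, 0 <= C & forall t u s y z i, (0 < t)%N -> in_box y z ->
  `|upd_y t u s y z i - y i - gamma / t%:R * drift u y z i| <= C / t%:R ^+ 2.
Proof.
exists (gamma * (nb * (2 * M)) + gamma * (nb * beta)).
  by rewrite addr_ge0// !mulr_ge0// ltW.
move=> t u s y z i t0 yz; have [yM zM] := yz.
have tgt0 : 0 < t%:R :> R by rewrite ltr0n.
rewrite /upd_y (addrAC (y i)) subrr add0r.
set S := \sum_p _; set T := t%:R in tgt0 *.
have SB : `|S| <= nb * (2 * M).
  apply: norm_sum_le => p; rewrite normrM.
  have /andP[W0 W1] := Wmat_le1 u i p; rewrite ger0_norm//.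
  apply: (@le_trans _ _ (1 * (2 * M))); last by rewrite mul1r.
  by apply: ler_pM => //; apply: diff_norm_le => //; exact: upd_z_norm.
have SD : `|S - drift u y z i| <= nb * (beta / T).
  rewrite /S /drift -sumrB; apply: norm_sum_le => p.
  rewrite -mulrBr opprB addrA subrK normrM.
  have /andP[W0 W1] := Wmat_le1 u i p; rewrite ger0_norm//.
  rewrite -[X in _ <= X]mul1r; apply: ler_pM => //; exact: upd_z_close.
have T1 : t.+1%:R = T + 1 :> R by rewrite -natr1.
have -> : gamma / t.+1%:R * S - gamma / T * drift u y z i =
  gamma / T * (S - drift u y z i) - gamma * S * (T * (T + 1))^-1.
  rewrite T1; field; rewrite gt_eqF//= gt_eqF//; lra.
apply: (le_trans (ler_normB _ _)); rewrite mulrDl addrC; apply: lerD.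
  rewrite normrM; apply: ler_pM => //.
    by rewrite normrM gtr0_norm// ler_pM2l.
  rewrite gtr0_norm ?invr_gt0 ?mulr_gt0//; last by lra.
  rewrite lef_pV2 ?posrE ?exprn_gt0 ?mulr_gt0 //; last by lra.
  by rewrite expr2 ler_pM2l//; lra.
rewrite normrM gtr0_norm ?divr_gt0//.
apply: (@le_trans _ _ (gamma / T * (nb * (beta / T)))).
  by rewrite ler_pM2l ?divr_gt0.
by rewrite le_eqVlt; apply/orP; left; apply/eqP; field; rewrite gt_eqF.
Qed.

(** The new [y i] is a convex combination of [y i] and the estimates: the step-size condition makes
    the weight of [y i] nonnegative. *)
Lemma upd_box t u s y z : gamma * (dmax' E)%:R <= t.+1%:R -> in_box y z ->
  in_box (upd_y t u s y z) (upd_z t u s z).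
Proof.
move=> gd [yM zM]; split=> [i|p]; last exact: upd_z_norm.
rewrite /upd_y; set k := gamma / t.+1%:R.
have k0 : 0 < k by rewrite divr_gt0 ?ltr0n.
have Wsum : \sum_p Wmat E u i p = #|E u i|%:R :> R.
  have := sum_Wmat E u i (fun=> 1 : R); under eq_bigr do rewrite mulr1.
  by move=> ->; rewrite sumr_const.
have kW : k * #|E u i|%:R <= 1.
  rewrite /k mulrAC ler_pdivrMr ?ltr0n// mul1r; apply: le_trans gd.
  rewrite ler_pM2l// ler_nat; apply: (@leq_trans (deg' E i)); last exact: leq_bigmax.
  rewrite /deg' card_mkset; apply: subset_leq_card; apply/fintype.subsetP => j ij.
  by apply/existsP; exists u.
have -> : y i + k * \sum_p Wmat E u i p * (upd_z t u s z p - y i) =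
    (1 - k * #|E u i|%:R) * y i + k * \sum_p Wmat E u i p * upd_z t u s z p.
  under eq_bigr do rewrite mulrBr; rewrite sumrB -mulr_suml Wsum; ring.
apply: (@le_trans _ _ ((1 - k * #|E u i|%:R) * M + k * (#|E u i|%:R * M))); last lra.
apply: (le_trans (ler_normD _ _)); apply: lerD; rewrite normrM ger0_norm ?subr_ge0 ?(ltW k0)//.
  by apply: ler_wpM2l; rewrite ?subr_ge0.
rewrite ler_pM2l// -Wsum mulr_suml; apply: (le_trans (ler_norm_sum _ _ _)).
apply: ler_sum => p _; have /andP[W0 W1] := Wmat_le1 u i p; rewrite normrM ger0_norm//.
by apply: ler_wpM2l => //; exact: upd_z_norm.
Qed.

End UpdateStep.

Lemma mulr_norm_le (R : realType) (a b A B : R) : `|a| <= A -> `|b| <= B -> `|a * b| <= A * B.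
Proof. by move=> aA bB; rewrite normrM ler_pM. Qed.

(** Under a product weight the other coordinates sum out to 1, once [f] is absorbed into the factor
    at [i0]. *)
Lemma sum_ffun_marginal (R : realType) (I : finType) (w : I -> bool -> R) (i0 : I)
    (f : bool -> R) : (forall i, w i true + w i false = 1) ->
  \sum_(s : {ffun I -> bool}) (\prod_i w i (s i)) * f (s i0) =
  w i0 true * f true + w i0 false * f false.
Proof.
move=> w1; pose w' i b := w i b * (if i == i0 then f b else 1).
transitivity (\sum_(s : {ffun I -> bool}) \prod_i w' i (s i)).
  apply: eq_bigr => s _; rewrite /w' big_split/=; congr (_ * _).
  by rewrite (bigD1 i0)//= eqxx big1 ?mulr1// => i /negbTE ->.
rewrite -(bigA_distr_bigA w') (bigD1 i0)//= [X in _ * X]big1 => [|i /negbTE i0i].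
  by rewrite mulr1 big_bool /w' eqxx.
by rewrite big_bool /w' /= i0i !mulr1 w1.
Qed.

Section Expansions.
Context {R : realType} {N h : nat} (E : 'I_h -> rel 'I_N).
Context (c : 'I_N -> 'I_N -> R) (sigma M beta gamma : R).
Hypotheses (M_gt0 : 0 < M) (N2 : (2 <= N)%N).
Hypotheses (beta_gt0 : 0 < beta) (gamma_gt0 : 0 < gamma).
Hypothesis simpleE : forall u, undirected_simple N (E u).

Local Notation bits := {ffun pairT E -> bool}.
Implicit Types (y : 'I_N -> R) (z : pairT E -> R) (u : 'I_h) (s : bits).
Local Notation uz := (upd_z c sigma M beta).
Local Notation uy := (upd_y c sigma M beta gamma).
Local Notation box := (@in_box R N h E M).

Let nb : R := #|{: pairT E}|%:R.
Let nb_ge0 : 0 <= nb. Proof. exact: ler0n. Qed.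

Lemma sum_dev y : \sum_i dev y i = 0.
Proof.
rewrite /dev sumrB sumr_const card_ord /mean -[X in _ - X]mulr_natl mulrA divff ?mul1r ?subrr//.
by rewrite pnatr_eq0; case: N N2.
Qed.

(** Deviations sum to 0, so the mean of [r] is invisible in the cross term; in the square the
    discarded term is N times the squared mean of [r]. *)
Lemma disagr_add y (r : 'I_N -> R) :
  disagr (fun i => y i + r i) <= disagr y + 2 * \sum_i dev y i * r i + \sum_i r i ^+ 2.
Proof.
have devD i : dev (fun i => y i + r i) i = dev y i + dev r i.
  by rewrite /dev /mean big_split/=; ring.
rewrite /disagr; under eq_bigr do rewrite devD sqrrD.
have -> : \sum_i (dev y i ^+ 2 + dev y i * dev r i *+ 2 + dev r i ^+ 2) =
   disagr y + 2 * \sum_i dev y i * r i + \sum_i dev r i * r i.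
  rewrite !big_split/=; congr (_ + _ + _).
    rewrite -mulr2n mulr_natl; congr (_ *+ _).
    under eq_bigr do rewrite {2}/dev mulrBr.
    by rewrite sumrB -mulr_suml sum_dev mul0r subr0.
  under eq_bigr do rewrite expr2 {2}/dev mulrBr.
  by rewrite sumrB -mulr_suml sum_dev mul0r subr0.
rewrite lerD2l; under eq_bigr do rewrite /dev mulrBl -expr2.
rewrite sumrB -mulr_sumr gerBl /mean -mulrA -expr2 mulr_ge0 ?sqr_ge0//.
Qed.

Lemma dev_norm y z i : box y z -> `|dev y i| <= 2 * M.
Proof.
move=> [yM _]; apply: diff_norm_le => //; rewrite /mean normrM.
have N0 : 0 < N%:R :> R by rewrite ltr0n; case: N N2.
rewrite gtr0_norm ?invr_gt0// ler_pdivrMl//.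
by have := norm_sum_le yM; rewrite card_ord.
Qed.

Lemma disagr_upd : exists2 C, 0 <= C & forall t u s y z, (0 < t)%N -> box y z ->
  disagr (uy t u s y z) <=
  disagr y + 2 * gamma / t%:R * \sum_i dev y i * drift u y z i + C / t%:R ^+ 2.
Proof.
have [C1 C10 close] := upd_y_close E c sigma beta M_gt0 gamma_gt0.
have [C2 C20 lin] := upd_y_linear E c sigma M_gt0 beta_gt0 gamma_gt0.
exists (2 * (N%:R * (2 * M * C2)) + N%:R * (C1 * C1)).
  by rewrite addr_ge0 ?mulr_ge0 ?ler0n// ltW.
move=> t u s y z t0 yz.
have tgt0 : 0 < t%:R :> R by rewrite ltr0n.
pose r i := uy t u s y z i - y i.
pose rho i := r i - gamma / t%:R * drift u y z i.
have -> : uy t u s y z = fun i => y i + r i.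
  by apply/funext => i; rewrite /r addrC subrK.
apply: (le_trans (disagr_add _ _)).
have -> : \sum_i dev y i * r i =
    gamma / t%:R * \sum_i dev y i * drift u y z i + \sum_i dev y i * rho i.
  rewrite mulr_sumr -big_split/=; apply: eq_bigr => i _; rewrite /rho; ring.
have H1 : \sum_i dev y i * rho i <= N%:R * (2 * M * (C2 / t%:R ^+ 2)).
  apply: (le_trans (ler_norm _)); rewrite -[in X in _ <= X](card_ord N).
  apply: norm_sum_le => i; apply: mulr_norm_le; last exact: lin.
  exact: dev_norm yz.
have H2 : \sum_i r i ^+ 2 <= N%:R * (C1 / t%:R * (C1 / t%:R)).
  apply: (le_trans (ler_norm _)); rewrite -[in X in _ <= X](card_ord N).
  by apply: norm_sum_le => i; rewrite expr2; apply: mulr_norm_le; exact: close.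
move: H1 H2; rewrite (_ : N%:R * (2 * M * (C2 / t%:R ^+ 2)) =
  N%:R * (2 * M * C2) / t%:R ^+ 2); last by field; rewrite gt_eqF.
rewrite (_ : N%:R * (C1 / t%:R * (C1 / t%:R)) = N%:R * (C1 * C1) / t%:R ^+ 2).
  lra.
by field; rewrite gt_eqF.
Qed.

Lemma esterr_upd : exists2 C, 0 <= C & forall t u s y z, (0 < t)%N -> box y z ->
  esterr (uy t u s y z) (uz t u s z) <= esterr y z +
  2 * beta / t%:R * (\sum_p edge u p * eps y z p *
                       (Fn sigma (thr c p - z p) - (s p)%:R)) -
  2 * gamma / t%:R * (\sum_p eps y z p * drift u y z (val p).2) + C / t%:R ^+ 2.
Proof.
have [C1 C10 close] := upd_y_close E c sigma beta M_gt0 gamma_gt0.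
have [C2 C20 lin] := upd_y_linear E c sigma M_gt0 beta_gt0 gamma_gt0.
pose C := beta ^+ 2 + 2 * (2 * M * C2) + 2 * (beta * C1) + C1 * C1.
exists (nb * C).
  rewrite mulr_ge0// !addr_ge0 ?sqr_ge0 ?mulr_ge0//; exact: ltW.
move=> t u s y z t0 yz; have [yM zM] := yz.
have tgt0 : 0 < t%:R :> R by rewrite ltr0n.
rewrite /esterr !mulr_sumr.
have -> : nb * C / t%:R ^+ 2 = \sum_(p : pairT E) C / t%:R ^+ 2.
  by rewrite sumr_const -[RHS]mulr_natl mulrA.
rewrite -big_split/= -sumrB -big_split/=; apply: ler_sum => p _.
set r := uy t u s y z (val p).2 - y (val p).2.
pose rho := r - gamma / t%:R * drift u y z (val p).2.
have r1 : `|r| <= C1 / t%:R by exact: close.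
have rho1 : `|rho| <= C2 / t%:R ^+ 2 by exact: lin.
have z1 : `|uz t u s z p - z p| <= beta / t%:R by apply: upd_z_close => //; exact: yz.
have e1 : `|eps y z p| <= 2 * M by exact: diff_norm_le.
have := upd_z_sqr c sigma M_gt0 beta_gt0 u s p t0 yz.
set Z := edge u p * _ * _ => zsq.
(* Square of (z' - y) - [r], with [r] split into its linear part and [rho]: besides the first
   square, only the drift term is of order 1/t. *)
have -> : eps (uy t u s y z) (uz t u s z) p ^+ 2 =
  (uz t u s z p - y (val p).2) ^+ 2 - 2 * gamma / t%:R * (eps y z p * drift u y z (val p).2)
  - 2 * (eps y z p * rho) - 2 * ((uz t u s z p - z p) * r) + r * r.
  rewrite /eps /rho /r; ring.
have A1 : `|eps y z p * rho| <= 2 * M * (C2 / t%:R ^+ 2) by exact: mulr_norm_le.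
have A2 : `|(uz t u s z p - z p) * r| <= beta / t%:R * (C1 / t%:R) by exact: mulr_norm_le.
have A3 : `|r * r| <= C1 / t%:R * (C1 / t%:R) by exact: mulr_norm_le.
have -> : C / t%:R ^+ 2 = beta ^+ 2 / t%:R ^+ 2 + 2 * (2 * M * (C2 / t%:R ^+ 2)) +
   2 * (beta / t%:R * (C1 / t%:R)) + C1 / t%:R * (C1 / t%:R).
  by rewrite /C; field; rewrite gt_eqF.
move: A1 A2 A3; rewrite !ler_norml => /andP[a1 _] /andP[a2 _] /andP[_ a3].
lra.
Qed.

(** The consensus input splits into an estimation part through [W_u] and a Laplacian part, in which
    constants vanish and [dev y] can stand for [y]. *)
Lemma drift_eps_dev u y z i :
  drift u y z i = \sum_p Wmat E u i p * eps y z p - \sum_j lap E u i j * dev y j.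
Proof.
rewrite lap_apply -(sum_Wmat E u i (fun j => dev y i - dev y j)) -sumrB.
by apply: eq_bigr => p _; rewrite /eps /dev; ring.
Qed.

Context (lam2 : R).
Hypotheses (lam2_gt0 : 0 < lam2) (lG_gt0 : 0 < lambdaG E :> R).

Local Notation lG := (lambdaG E : R).

(** The Laplacian part is kept as an exact edge sum: one graph alone need not be connected and
    offers no gap. *)
Lemma dev_drift_le u y z :
  2 * \sum_i dev y i * drift u y z i <=
  lam2 * disagr y + lG / lam2 * esterr y z -
  \sum_(p : pairT E) edge u p * (y (val p).1 - y (val p).2) ^+ 2.
Proof.
have -> : \sum_i dev y i * drift u y z i =
   \sum_i dev y i * (\sum_p Wmat E u i p * eps y z p) -
   \sum_i dev y i * (\sum_j lap E u i j * dev y j).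
  by rewrite -sumrB; apply: eq_bigr => i _; rewrite drift_eps_dev mulrBr.
rewrite mulrBr lap_form//.
under [X in _ - X <= _]eq_bigr => p _.
  rewrite (_ : dev y _ - dev y _ = y (val p).1 - y (val p).2); last by rewrite /dev; ring.
over.
rewrite lerD2r; exact: cross_delta_W (sum_dev y).
Qed.

Lemma eps_drift_ge u y z :
  - (2 * \sum_p eps y z p * drift u y z (val p).2) <=
  alphaC E lam2 * esterr y z + lG / lam2 * disagr y.
Proof.
have -> : \sum_p eps y z p * drift u y z (val p).2 =
   \sum_p eps y z p * (\sum_q Wmat E u (val p).2 q * eps y z q) -
   \sum_p eps y z p * (\sum_j lap E u (val p).2 j * dev y j).
  by rewrite -sumrB; apply: eq_bigr => p _; rewrite drift_eps_dev mulrBr.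
have := cross_eps_QW u (eps y z); have := cross_eps_QL lam2_gt0 u (dev y) (eps y z) lG_gt0.
rewrite -/(esterr y z) -/(disagr y) /alphaC; lra.
Qed.

Lemma step_bound (q : R) : 0 < q ->
  exists2 C, 0 <= C & forall t u s y z, (0 < t)%N -> box y z ->
  disagr (uy t u s y z) + q * esterr (uy t u s y z) (uz t u s z) <=
  disagr y + q * esterr y z + t%:R^-1 *
   (gamma * lam2 * disagr y + gamma * lG / lam2 * esterr y z
    + q * (gamma * alphaC E lam2 * esterr y z + gamma * lG / lam2 * disagr y)
    - gamma * \sum_(p : pairT E) edge u p * (y (val p).1 - y (val p).2) ^+ 2)
   + C / t%:R ^+ 2
   + 2 * beta * q / t%:R * (\sum_p edge u p * eps y z p *
                       (Fn sigma (thr c p - z p) - (s p)%:R)).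
Proof.
move=> q0; have [C1 C10 H1] := disagr_upd; have [C2 C20 H2] := esterr_upd.
exists (C1 + q * C2); first by rewrite addr_ge0 ?mulr_ge0// ltW.
move=> t u s y z t0 yz; have := H1 t u s y z t0 yz; have := H2 t u s y z t0 yz.
have tgt0 : 0 < t%:R :> R by rewrite ltr0n.
set F := \sum_p edge u p * _ * _; set D1 := \sum_i dev y i * _.
set D2 := \sum_p eps y z p * _; set Ed := \sum_p edge u p * _ ^+ 2.
have := dev_drift_le u y z; have := eps_drift_ge u y z; rewrite -/D1 -/D2 -/Ed.
set V := disagr y; set W := esterr y z; set V' := disagr _; set W' := esterr _ _.
set al := alphaC _ _; move=> B2 B1 W1 V1.
have gt0 : 0 < gamma / t%:R by rewrite divr_gt0.
have qgt0 : 0 < q * (gamma / t%:R) by rewrite mulr_gt0.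
have B1' : gamma / t%:R * (2 * D1) <= gamma / t%:R * (lam2 * V + lG / lam2 * W - Ed).
  by rewrite ler_pM2l.
have B2' : q * (gamma / t%:R) * (- (2 * D2)) <= q * (gamma / t%:R) * (al * W + lG / lam2 * V).
  by rewrite ler_pM2l.
have W1' : q * W' <= q * (W + 2 * beta / t%:R * F - 2 * gamma / t%:R * D2 + C2 / t%:R ^+ 2).
  by rewrite ler_pM2l.
rewrite (_ : _ + _ * W + _ * _ + _ + _ =
   (V + gamma / t%:R * (lam2 * V + lG / lam2 * W - Ed) + C1 / t%:R ^+ 2)
   + (q * (W + 2 * beta / t%:R * F + C2 / t%:R ^+ 2) +
      q * (gamma / t%:R) * (al * W + lG / lam2 * V))).
  lra.
by field; rewrite !gt_eqF.
Qed.

End Expansions.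

(** * Drift of the Lyapunov function *)

Section LyapunovDrift.
Context {R : realType} {N h : nat} (E : 'I_h -> rel 'I_N).
Context (c : 'I_N -> 'I_N -> R) (sigma M beta gamma : R) (Pm : 'M[R]_h) (pi : 'I_h -> R).
Hypotheses (sigma_gt0 : 0 < sigma) (M_gt0 : 0 < M) (N2 : (2 <= N)%N).
Hypotheses (beta_gt0 : 0 < beta) (gamma_gt0 : 0 < gamma).
Hypothesis simpleE : forall u, undirected_simple N (E u).
Hypothesis stoch : stochastic Pm.

Local Notation bits := {ffun pairT E -> bool}.
Implicit Types (y : 'I_N -> R) (z : pairT E -> R) (u : 'I_h) (s : bits).
Local Notation uz := (upd_z c sigma M beta).
Local Notation uy := (upd_y c sigma M beta gamma).
Local Notation box := (@in_box R N h E M).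
Local Notation f := (fM E sigma M c).

Definition bit_weight y (p : pairT E) (b : bool) : R :=
  if b then Fn sigma (thr c p - y (val p).2) else 1 - Fn sigma (thr c p - y (val p).2).

Definition bits_weight y s : R := \prod_p bit_weight y p (s p).

Lemma bits_weight_ge0 y s : 0 <= bits_weight y s.
Proof.
apply: prodr_ge0 => p _; rewrite /bit_weight; case: ifP => _; first exact: Fn_ge0.
by rewrite subr_ge0 Fn_le1.
Qed.

Lemma bit_weight_sum y p : bit_weight y p true + bit_weight y p false = 1.
Proof. by rewrite /bit_weight addrC subrK. Qed.

Lemma sum_bits_weight y : \sum_s bits_weight y s = 1.
Proof.
rewrite /bits_weight -(bigA_distr_bigA (bit_weight y)) big1// => p _.
by rewrite big_bool/= bit_weight_sum.
Qed.

(** Only marginals enter, since the integrand is affine in the bits: each bit is replaced by its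
    conditional mean. *)
Lemma sum_bits_weight_affine y (A k : R) (a F : pairT E -> R) :
  \sum_s bits_weight y s * (A + k * \sum_p a p * (F p - (s p)%:R)) =
  A + k * \sum_p a p * (F p - Fn sigma (thr c p - y (val p).2)).
Proof.
under eq_bigr do rewrite mulrDr mulrCA mulr_sumr.
rewrite big_split/= -mulr_suml sum_bits_weight mul1r -mulr_sumr; congr (_ + _ * _).
rewrite exchange_big/=; apply: eq_bigr => p _.
rewrite (sum_ffun_marginal p (fun b => a p * (F p - b%:R)) (bit_weight_sum y)).
rewrite /bit_weight/=; ring.
Qed.

(** Transition operator of the Markov chain: [u] is the mode of the previous time, and the mode [v]
    drawn from it selects the graph of step [t]. *)
Definition Tstep t (phi : 'I_h -> ('I_N -> R) -> (pairT E -> R) -> R) u y z : R :=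
  \sum_v Pm u v * \sum_s bits_weight y s * phi v (uy t v s y z) (uz t v s z).

Lemma Tstep_le t phi psi u y z :
  (forall v s, phi v (uy t v s y z) (uz t v s z) <= psi v s) ->
  Tstep t phi u y z <= \sum_v Pm u v * \sum_s bits_weight y s * psi v s.
Proof.
case: stoch => P0 _ H; apply: ler_sum => v _; apply: ler_wpM2l => //.
by apply: ler_sum => s _; apply: ler_wpM2l => //; exact: bits_weight_ge0.
Qed.

Context (q : R).
Hypothesis q_gt0 : 0 < q.

(** Everything that one edge indicator multiplies in the drift: the Laplacian dissipation and the
    contraction of the estimate along that edge. *)
Definition edge_energy y z (p : pairT E) : R :=
  gamma * (y (val p).1 - y (val p).2) ^+ 2 + 2 * beta * q * f * eps y z p ^+ 2.

Let f_gt0 : 0 < f. Proof. exact: fM_gt0. Qed.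
Let k_ge0 : 0 <= 2 * beta * q * f.
Proof. by rewrite !mulr_ge0// ltW. Qed.

Lemma sqr_sub_norm_le (a b B e : R) : `|a| <= B -> `|b| <= B -> `|a - b| <= e ->
  `|a ^+ 2 - b ^+ 2| <= e * (2 * B).
Proof.
move=> aB bB ab; rewrite subr_sqr; apply: mulr_norm_le => //.
by apply: (le_trans (ler_normD _ _)); lra.
Qed.

Lemma edge_energy_bound : exists2 C, 0 <= C & forall y z p, box y z ->
  `|edge_energy y z p| <= C.
Proof.
have M2 : 0 <= 2 * M by rewrite mulr_ge0// ltW.
exists (gamma * ((2 * M) * (2 * M)) + 2 * beta * q * f * ((2 * M) * (2 * M))).
  by apply: addr_ge0; apply: mulr_ge0 (mulr_ge0 M2 M2) => //; exact: ltW.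
move=> y z p [yM zM]; apply: (le_trans (ler_normD _ _)).
have e1 : `|eps y z p| <= 2 * M by exact: diff_norm_le.
have y1 : `|y (val p).1 - y (val p).2| <= 2 * M by exact: diff_norm_le.
apply: lerD.
  rewrite normrM (gtr0_norm gamma_gt0) ler_pM2l// expr2; exact: mulr_norm_le.
by rewrite normrM (ger0_norm k_ge0) ler_wpM2l// expr2; exact: mulr_norm_le.
Qed.

Lemma edge_energy_lip : exists2 C, 0 <= C & forall t u s y z p, (0 < t)%N ->
  gamma * (dmax' E)%:R <= t.+1%:R -> box y z ->
  `|edge_energy (uy t u s y z) (uz t u s z) p - edge_energy y z p| <= C / t%:R.
Proof.
have [C1 C10 close] := upd_y_close E c sigma beta M_gt0 gamma_gt0.
have M4 : 0 <= 2 * (2 * M) by rewrite !mulr_ge0// ltW.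
have g0 := ltW gamma_gt0; have b0 := ltW beta_gt0.
exists (gamma * ((C1 + C1) * (2 * (2 * M))) +
        2 * beta * q * f * ((beta + C1) * (2 * (2 * M)))).
  by apply: addr_ge0; apply: mulr_ge0 => //; apply: mulr_ge0 => //; exact: addr_ge0.
move=> t u s y z p t0 gd yz; have yz' := upd_box c sigma beta M_gt0 gamma_gt0 u s gd yz.
have [yM zM] := yz; have [yM' zM'] := yz'.
have c1 := close t u s y z (val p).1 t0 yz; have c2 := close t u s y z (val p).2 t0 yz.
have c3 : `|uz t u s z p - z p| <= beta / t%:R by apply: upd_z_close => //; exact: yz.
rewrite /edge_energy; set y' := uy _ _ _ _ _ in yM' c1 c2 *.
set z' := uz _ _ _ _ in zM' c3 *.
have A1 : `|(y' (val p).1 - y' (val p).2) ^+ 2 - (y (val p).1 - y (val p).2) ^+ 2| <=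
   (C1 + C1) / t%:R * (2 * (2 * M)).
  apply: sqr_sub_norm_le; [exact: diff_norm_le|exact: diff_norm_le|].
  rewrite (_ : _ - _ = (y' (val p).1 - y (val p).1) - (y' (val p).2 - y (val p).2)); last by ring.
  by rewrite mulrDl; apply: (le_trans (ler_normB _ _)); exact: lerD.
have A2 : `|eps y' z' p ^+ 2 - eps y z p ^+ 2| <= (beta + C1) / t%:R * (2 * (2 * M)).
  apply: sqr_sub_norm_le; [exact: diff_norm_le|exact: diff_norm_le|].
  rewrite /eps (_ : _ - _ = (z' p - z p) - (y' (val p).2 - y (val p).2)); last by ring.
  by rewrite mulrDl; apply: (le_trans (ler_normB _ _)); exact: lerD.
set D1 := (X in `|X| <= _) in A1; set D2 := (X in `|X| <= _) in A2.
rewrite (_ : _ - _ = gamma * D1 + 2 * beta * q * f * D2); last by rewrite /D1 /D2; ring.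
apply: (le_trans (ler_normD _ _)).
rewrite !(normrM _ D1) !(normrM _ D2) (ger0_norm g0) (ger0_norm k_ge0).
have B1 := ler_wpM2l g0 A1; have B2 := ler_wpM2l k_ge0 A2.
rewrite [X in _ <= X](_ : _ = gamma * ((C1 + C1) / t%:R * (2 * (2 * M))) +
   2 * beta * q * f * ((beta + C1) / t%:R * (2 * (2 * M)))); last by ring.
lra.
Qed.

Context (psi : pairT E -> 'I_h -> R).

Definition corrector u y z : R := \sum_p psi p u * edge_energy y z p.

(** Index [t] refers to the state before step [t.+1]; the corrector therefore carries the step size
    of the step to come. *)
Definition lyap t u y z : R :=
  disagr y + q * esterr y z + t.+1%:R^-1 * corrector u y z.

Lemma psi_bounded : exists2 B, 0 <= B & forall p u, `|psi p u| <= B.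
Proof.
exists (\sum_p \sum_u `|psi p u|); first by do 2 (apply: sumr_ge0 => ? _).
move=> p u; rewrite (bigD1 p)//= (bigD1 u)//= -addrA lerDl.
by rewrite addr_ge0//; [apply: sumr_ge0|apply: sumr_ge0 => ? _; apply: sumr_ge0].
Qed.

Lemma corrector_bound : exists2 C, 0 <= C & forall u y z, box y z -> `|corrector u y z| <= C.
Proof.
have [B B0 psiB] := psi_bounded; have [C C0 hC] := edge_energy_bound.
exists (#|{: pairT E}|%:R * (B * C)); first by rewrite !mulr_ge0.
move=> u y z yz; apply: norm_sum_le => p; apply: mulr_norm_le => //; exact: hC.
Qed.

(** The new mode [v] stands on both sides. Resetting [y], [z] and the prefactor costs O(1/t^2),
    because the energies are bounded and move by O(1/t). The mode itself jumps by O(1), and that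
    part is left to the Poisson equation. *)
Lemma corrector_step : exists2 C, 0 <= C & forall t u v s y z, (0 < t)%N ->
  gamma * (dmax' E)%:R <= t.+1%:R -> box y z ->
  t.+1%:R^-1 * corrector v (uy t u s y z) (uz t u s z) <=
  t%:R^-1 * corrector v y z + C / t%:R ^+ 2.
Proof.
have [B B0 psiB] := psi_bounded; have [C1 C10 hC1] := corrector_bound.
have [C2 C20 hC2] := edge_energy_lip.
exists (C1 + #|{: pairT E}|%:R * (B * C2)); first by rewrite addr_ge0 ?mulr_ge0.
move=> t u v s y z t0 gd yz; have yz' := upd_box c sigma beta M_gt0 gamma_gt0 u s gd yz.
have tgt0 : 0 < t%:R :> R by rewrite ltr0n.
have := hC1 v _ _ yz'; set H' := corrector v _ _ => H'1.
set H := corrector v y z.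
have HH : `|H' - H| <= #|{: pairT E}|%:R * (B * (C2 / t%:R)).
  rewrite /H' /H /corrector -sumrB; apply: norm_sum_le => p; rewrite -mulrBr.
  by apply: mulr_norm_le => //; exact: hC2.
have T1 : t.+1%:R = t%:R + 1 :> R by rewrite -natr1.
have -> : t.+1%:R^-1 * H' = t%:R^-1 * H + t%:R^-1 * (H' - H) - (t%:R * (t%:R + 1))^-1 * H'.
  by rewrite T1; field; rewrite gt_eqF//= gt_eqF//; lra.
have A1 : t%:R^-1 * (H' - H) <= #|{: pairT E}|%:R * (B * C2) / t%:R ^+ 2.
  apply: (@le_trans _ _ (t%:R^-1 * (#|{: pairT E}|%:R * (B * (C2 / t%:R))))).
    by rewrite ler_pM2l ?invr_gt0//; exact: le_trans (ler_norm _) HH.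
  by rewrite le_eqVlt; apply/orP; left; apply/eqP; field; rewrite gt_eqF.
have A2 : - ((t%:R * (t%:R + 1))^-1 * H') <= C1 / t%:R ^+ 2.
  apply: (le_trans (ler_norm _)); rewrite normrN mulrC; apply: mulr_norm_le => //.
  have t2 : 0 < t%:R * (t%:R + 1) :> R by rewrite mulr_gt0//; lra.
  rewrite gtr0_norm ?invr_gt0// lef_pV2 ?posrE ?exprn_gt0//.
  by rewrite expr2 ler_pM2l//; lra.
rewrite mulrDl; lra.
Qed.

Context (lam2 kappa : R).
Hypotheses (lam2_gt0 : 0 < lam2) (lG_gt0 : 0 < lambdaG E :> R).
Hypothesis gap : forall y, \sum_i y i = 0 ->
    2 * (lam2 * \sum_i y i ^+ 2) <=
    \sum_(p : pairT E) avg_edge pi p * (y (val p).1 - y (val p).2) ^+ 2.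
Hypothesis pi_gt0 : forall u, 0 < pi u.
Hypothesis poisson : forall p u,
  psi p u - \sum_v Pm u v * psi p v = avg_edge pi p - \sum_v Pm u v * edge v p.
Hypothesis kappa_disagr : kappa + q * (gamma * lambdaG E / lam2) <= gamma * lam2.
Hypothesis kappa_esterr : q * kappa + gamma * lambdaG E / lam2 <=
  q * (2 * beta * f * pi_min pi - gamma * alphaC E lam2).

Lemma avg_edge_energy_ge y z :
  2 * gamma * lam2 * disagr y + 2 * beta * q * f * pi_min pi * esterr y z <=
  \sum_p avg_edge pi p * edge_energy y z p.
Proof.
have -> : \sum_p avg_edge pi p * edge_energy y z p =
    gamma * (\sum_(p : pairT E) avg_edge pi p * (y (val p).1 - y (val p).2) ^+ 2) +
    2 * beta * q * f * (\sum_p avg_edge pi p * eps y z p ^+ 2).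
  rewrite !mulr_sumr -big_split/=; apply: eq_bigr => p _; rewrite /edge_energy; ring.
apply: lerD.
  rewrite (_ : 2 * gamma * _ * _ = gamma * (2 * (lam2 * disagr y))); last by ring.
  rewrite ler_pM2l//.
  have := gap (sum_dev N2 y); rewrite -/(disagr y).
  under eq_bigr => p _.
    rewrite (_ : dev y _ - dev y _ = y (val p).1 - y (val p).2); last by rewrite /dev; ring.
  over.
  by [].
rewrite -mulrA; apply: ler_wpM2l; first exact: k_ge0.
rewrite mulr_sumr; apply: ler_sum => p _; apply: ler_wpM2r; first exact: sqr_ge0.
exact: avg_edge_ge.
Qed.

Lemma lyap_drift : exists2 C, 0 <= C & forall t u y z,
  gamma * (dmax' E)%:R <= t.+2%:R -> box y z ->
  Tstep t.+1 (lyap t.+1) u y z <=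
  lyap t u y z - kappa / t.+1%:R * (disagr y + q * esterr y z) + C / t.+1%:R ^+ 2.
Proof.
have [C1 C10 HV] := step_bound c sigma M_gt0 N2 beta_gt0 gamma_gt0 simpleE
  lam2_gt0 lG_gt0 q_gt0.
have [C2 C20 HC] := corrector_step.
exists (C1 + C2); first exact: addr_ge0.
move=> t u y z gd yz; set T := t.+1%:R.
have Tgt0 : 0 < T by rewrite ltr0n.
set V := disagr y; set W := esterr y z.
pose K := gamma * lam2 * V + gamma * lambdaG E / lam2 * W
    + q * (gamma * alphaC E lam2 * W + gamma * lambdaG E / lam2 * V).
pose D v := \sum_(p : pairT E) edge v p * (y (val p).1 - y (val p).2) ^+ 2.
pose A v := V + q * W + T^-1 * (K - gamma * D v) + C1 / T ^+ 2
             + (T^-1 * corrector v y z + C2 / T ^+ 2).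
(* Averaging over the noise turns each bit into [Fn sigma (thr c p - y (val p).2)]. *)
have step1 : Tstep t.+1 (lyap t.+1) u y z <=
  \sum_v Pm u v * (A v + 2 * beta * q / T *
      \sum_p edge v p * eps y z p *
         (Fn sigma (thr c p - z p) - Fn sigma (thr c p - y (val p).2))).
  apply: (@le_trans _ _ (\sum_v Pm u v * \sum_s bits_weight y s *
     (A v + 2 * beta * q / T * \sum_p edge v p * eps y z p *
         (Fn sigma (thr c p - z p) - (s p)%:R)))).
    apply: Tstep_le => v s; rewrite /lyap.
    have := HV t.+1 v s y z isT yz; have := HC t.+1 v v s y z isT gd yz.
    rewrite -/V -/W -/(D v) -/K -/T /A => H1 H2; apply: (le_trans (lerD H2 H1)).
    by rewrite [X in _ <= X]addrAC.
  by apply: ler_sum => v _; rewrite sum_bits_weight_affine.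
apply: (le_trans step1).
(* Strong monotonicity gives [- f * eps ^+ 2] on each current edge, so all indicators now multiply
   [edge_energy] and merge with the corrector. *)
have {}step1 : \sum_v Pm u v * (A v + 2 * beta * q / T *
      \sum_p edge v p * eps y z p *
         (Fn sigma (thr c p - z p) - Fn sigma (thr c p - y (val p).2))) <=
   \sum_v Pm u v * (V + q * W + T^-1 * K + (C1 + C2) / T ^+ 2 +
      T^-1 * \sum_p (psi p v - edge v p) * edge_energy y z p).
  case: (stoch) => P0 _; apply: ler_sum => v _; apply: ler_wpM2l => //.
  have : \sum_p edge v p * eps y z p *
         (Fn sigma (thr c p - z p) - Fn sigma (thr c p - y (val p).2)) <=
         - (f * \sum_p edge v p * eps y z p ^+ 2).
    rewrite mulr_sumr -sumrN; apply: ler_sum => p _.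
    have [yM zM] := yz.
    have := Fn_monotone_bound c sigma_gt0 p (yM (val p).2) (zM p).
    move/(ler_wpM2l (@edge_ge0 R _ _ _ v p)); rewrite /eps /thr -mulrA => H; apply: (le_trans H).
    by rewrite mulrN mulrCA.
  set S1 := \sum_p _; set S2 := \sum_p _ => S12.
  have -> : \sum_p (psi p v - edge v p) * edge_energy y z p =
     corrector v y z - gamma * D v - 2 * beta * q * f * S2.
    rewrite /corrector /D /S2 !mulr_sumr -!sumrB; apply: eq_bigr => p _.
    rewrite /edge_energy; ring.
  have k0 : 0 < 2 * beta * q / T by rewrite divr_gt0// !mulr_gt0.
  have := ler_wpM2l (ltW k0) S12.
  rewrite /A => H; apply: (le_trans (lerD (lexx _) H)).
  by rewrite le_eqVlt; apply/orP; left; apply/eqP; ring.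
apply: (le_trans step1).
have sum_Pm X : \sum_v Pm u v * X = X by rewrite -mulr_suml; case: stoch => _ ->; rewrite mul1r.
(* Poisson equation: the mean of [psi p v - edge v p] over the next mode is
   [psi p u - avg_edge pi p]. The [psi] part rebuilds the corrector at the old mode. *)
have -> : \sum_v Pm u v * (V + q * W + T^-1 * K + (C1 + C2) / T ^+ 2 +
      T^-1 * \sum_p (psi p v - edge v p) * edge_energy y z p) =
   V + q * W + T^-1 * K + (C1 + C2) / T ^+ 2 +
   T^-1 * (corrector u y z - \sum_p avg_edge pi p * edge_energy y z p).
  under eq_bigr do rewrite mulrDr.
  rewrite big_split/= sum_Pm; congr (_ + _).
  under eq_bigr do rewrite mulrCA; rewrite -mulr_sumr; congr (_ * _).
  under [LHS]eq_bigr => v _ do rewrite mulr_sumr.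
  rewrite exchange_big/= /corrector -sumrB.
  apply: eq_bigr => p _; rewrite -mulrBl.
  under [LHS]eq_bigr => v _ do rewrite mulrA.
  rewrite -mulr_suml; congr (_ * _).
  under [LHS]eq_bigr => v _ do rewrite mulrBr.
  rewrite sumrB.
  by have := poisson p u; lra.
have := avg_edge_energy_ge y z; rewrite -/V -/W; set S := \sum_p _ => HS.
rewrite /lyap -/V -/W -/T.
have V0 : 0 <= V by apply: sumr_ge0 => i _; exact: sqr_ge0.
have W0 : 0 <= W by apply: sumr_ge0 => i _; exact: sqr_ge0.
(* The averaged energy contributes [- 2 gamma lam2] to the coefficient of [V], and
   [- 2 beta q f pi_min] to that of [W]; the two conditions on [kappa] are the comparison of
   coefficients. *)
have K1 : K - S <= - (kappa * (V + q * W)).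
  have := ler_wpM2r V0 kappa_disagr; have := ler_wpM2r W0 kappa_esterr.
  rewrite /K; lra.
have Ti : 0 <= T^-1 by rewrite invr_ge0 ltW.
have H := ler_wpM2l Ti K1.
rewrite [X in X <= _](_ : _ = V + q * W + T^-1 * corrector u y z + (C1 + C2) / T ^+ 2 +
  T^-1 * (K - S)); last by ring.
apply: (le_trans (lerD (lexx _) H)).
by rewrite le_eqVlt; apply/orP; left; apply/eqP; ring.
Qed.

End LyapunovDrift.

(** * Choice of the weights and the scalar recursion *)

(** At [kappa = k0] the conditions confine [q] to the interval from b/(d - k0) to (a - k0)/b, which
    is nondegenerate by the hypothesis. Its midpoint leaves slack in both conditions, and the slack
    is given to [kappa]. The cap 1/2 provides the upper bounds on [kappa] that the recursion lemmas
    ask for. *)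
Lemma choose_weights (R : realType) (a b d k0 : R) :
  k0 < a -> 0 < b -> b ^+ 2 < (a - k0) * (d - k0) ->
  exists kappa q, [/\ k0 < kappa, kappa <= k0 + 2^-1, 0 < q,
    kappa + q * b <= a & q * kappa + b <= q * d].
Proof.
move=> ka b0 H; pose a' := a - k0; pose d' := d - k0.
have a'0 : 0 < a' by rewrite /a'; lra.
have b2 : 0 < b ^+ 2 by rewrite exprn_gt0.
have d'0 : 0 < d' by rewrite -(pmulr_rgt0 d' a'0); exact: lt_trans b2 H.
have lo_hi : b / d' < a' / b by rewrite ltr_pdivrMr// mulrAC ltr_pdivlMr// -expr2.
have lo0 : 0 < b / d' by rewrite divr_gt0.
pose q := 2^-1 * (b / d' + a' / b).
have q1 : b / d' < q by rewrite /q; lra.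
have q2 : q < a' / b by rewrite /q; lra.
have q0 : 0 < q by lra.
have e1 : 0 < a' - q * b by move: q2; rewrite ltr_pdivlMr//; lra.
have e2 : 0 < d' - b / q.
  by rewrite subr_gt0 ltr_pdivrMr// mulrC; move: q1; rewrite ltr_pdivrMr.
pose e := Num.min (Num.min (a' - q * b) (d' - b / q)) 2^-1.
have e0 : 0 < e by rewrite !lt_min e1 e2/= invr_gt0.
have ea : e <= a' - q * b by rewrite !ge_min lexx.
have ed : e <= d' - b / q by rewrite !ge_min lexx orbT.
have eh : e <= 2^-1 by rewrite ge_min lexx orbT.
exists (k0 + e), q; split => //; [lra|lra|rewrite /a' in ea; lra|].
have := ler_wpM2l (ltW q0) ed; rewrite mulrBr [q * (b / q)]mulrC divfK ?gt_eqF// /d'; lra.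
Qed.

Section Recursion.
Context {R : realType} (w e : nat -> R) (t0 : nat) (kappa C D : R).
Hypotheses (C_ge0 : 0 <= C) (D_ge0 : 0 <= D) (kappa_gt0 : 0 < kappa).
Hypothesis e_ge0 : forall t, (t0 <= t)%N -> 0 <= e t.
Hypothesis e_le : forall t, (t0 <= t)%N -> e t <= w t + D / t.+1%:R.
Hypothesis w_le : forall t, (t0 <= t)%N -> w t <= e t + D / t.+1%:R.
Hypothesis w_rec : forall t, (t0 <= t)%N ->
  w t.+1 <= w t - kappa / t.+1%:R * e t + C / t.+1%:R ^+ 2.

(** [w] is the corrected function and may be negative, hence dissipation is first stated through
    [e]; returning to [w] costs [kappa * D] at order 1/t^2. *)
Lemma recursion_affine t : (t0 <= t)%N ->
  w t.+1 <= (1 - kappa / t.+1%:R) * w t + (C + kappa * D) / t.+1%:R ^+ 2.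
Proof.
move=> tt; have T0 : 0 < t.+1%:R :> R by rewrite ltr0n.
have kT : 0 <= kappa / t.+1%:R by rewrite divr_ge0 ?ltW.
have := ler_wpM2l kT (w_le tt); have := w_rec tt; move: (t.+1%:R) T0 {kT} => T T0.
rewrite (_ : (C + kappa * D) / _ = C / T ^+ 2 + kappa / T * (D / T)).
  lra.
by field; rewrite gt_eqF.
Qed.

(** The bound K/t reproduces itself as soon as [K * (kappa - 1)] dominates the forcing constant.
    [kappa <= 2] keeps the factor [1 - kappa / t.+1] nonnegative from [t = 1] on. *)
Lemma recursion_rate : 1 < kappa -> kappa <= 2 ->
  exists2 K : R, 0 < K & forall t, (t0 <= t)%N -> e t <= K / t.+1%:R.
Proof.
move=> k1 k2; pose C' := C + kappa * D.
have C'0 : 0 <= C' by rewrite addr_ge0 ?mulr_ge0// ltW.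
pose K : R := `|w t0.+1| * t0.+1%:R + C' / (kappa - 1).
have km : 0 < kappa - 1 by lra.
have K0 : 0 <= K.
  by apply: addr_ge0; [exact: mulr_ge0|apply: divr_ge0 => //; exact: ltW].
have KC : C' <= K * (kappa - 1).
  by rewrite -ler_pdivrMr// /K lerDr mulr_ge0.
have wK t : (t0 < t)%N -> w t <= K / t%:R.
  elim: t => // t IH; rewrite ltnS leq_eqVlt => /orP[/eqP <-|tt].
    rewrite ler_pdivlMr ?ltr0n//; apply: (@le_trans _ _ (`|w t0.+1| * t0.+1%:R)).
      by rewrite ler_wpM2r ?ler0n// ler_norm.
    by rewrite /K lerDl divr_ge0// ltW.
  apply: (le_trans (recursion_affine (ltnW tt))).
  have t_gt0 : 0 < t%:R :> R by rewrite ltr0n (leq_ltn_trans _ tt).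
  have t_ge1 : 1 <= t%:R :> R by rewrite ler1n (leq_ltn_trans _ tt).
  have T1 : t.+1%:R = t%:R + 1 :> R by rewrite -natr1.
  have T0 : 0 < t%:R + 1 :> R by lra.
  have k0 : 0 <= 1 - kappa / t.+1%:R by rewrite subr_ge0 ler_pdivrMr ?T1//; lra.
  have := ler_wpM2l k0 (IH tt); rewrite T1 -/C'; set T := t%:R in t_gt0 t_ge1 T0 *.
  move=> H; apply: (le_trans (lerD H (lexx _))).
  rewrite -subr_ge0 (_ : _ - _ =
    (K * (kappa - 1) * (T + 1) - C' * T) / (T * (T + 1) ^+ 2)).
    apply: divr_ge0; last by apply: mulr_ge0; [exact: ltW|exact: sqr_ge0].
    have := ler_wpM2r (ltW t_gt0) KC.
    have : 0 <= K * (kappa - 1) by apply: mulr_ge0 => //; exact: ltW.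
    lra.
  by field; rewrite !gt_eqF.
clearbody K.
have [E0 E00 eE0] : exists2 E0 : R, 0 <= E0 & e t0 * t0.+1%:R = E0.
  by exists (e t0 * t0.+1%:R) => //; apply: mulr_ge0 => //; exact: e_ge0.
(* [K + K] comes from 1/t <= 2/(t+1), [D] from passing from [w] to [e], [E0] covers the index [t0]
   omitted by [wK], and 1 gives positivity. *)
exists (K + K + D + E0 + 1); first by have := D_ge0; lra.
move=> t; rewrite leq_eqVlt => /orP[/eqP <-|tt].
  by rewrite ler_pdivlMr ?ltr0n// eE0; have := D_ge0; lra.
apply: (le_trans (e_le (ltnW tt))).
have t_ge1 : 1 <= t%:R :> R by rewrite ler1n (leq_ltn_trans _ tt).
have T1 : t.+1%:R = t%:R + 1 :> R by rewrite -natr1.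
have T0 : 0 < t%:R + 1 :> R by lra.
have := wK t tt; set T := t%:R in t_ge1 T0 T1 *; rewrite T1.
move=> wT; have KT : K / T <= (K + K) / (T + 1).
  rewrite ler_pdivrMr; last lra.
  rewrite mulrAC ler_pdivlMr//; have := ler_wpM2l K0 t_ge1; lra.
apply: (@le_trans _ _ ((K + K) / (T + 1) + D / (T + 1))).
  by apply: lerD => //; exact: le_trans KT.
by rewrite -mulrDl ler_pM2r ?invr_gt0//; lra.
Qed.

(** Adding B/t to [w] absorbs the forcing, because 1/t decreases more slowly than the factor
    [1 - kappa / t.+1] when [kappa < 1]. The resulting homogeneous recursion is then compared with
    harmonic sums. *)
Lemma recursion_cvg : kappa <= 2^-1 ->
  forall r, 0 < r -> exists t1, forall t, (t1 <= t)%N -> e t <= r.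
Proof.
move=> k2 r r0; pose C' := C + kappa * D.
have C'0 : 0 <= C' by rewrite addr_ge0 ?mulr_ge0// ltW.
have km : 0 < 1 - kappa by lra.
(* First summand: absorbs the forcing. Second summand: makes [v] dominate [e], hence nonnegative. *)
pose B := C' / (1 - kappa) + D.
have BD : D <= B by rewrite /B lerDr; apply: divr_ge0 => //; exact: ltW.
have BC : C' <= B * (1 - kappa).
  by rewrite -ler_pdivrMr// /B lerDl.
have B0 : 0 <= B by exact: le_trans BD.
pose v t := w t + B / t%:R.
have ev t : (t0 < t)%N -> e t <= v t.
  move=> tt; apply: (le_trans (e_le (ltnW tt))); rewrite /v lerD2l.
  have t_gt0 : 0 < t%:R :> R by rewrite ltr0n (leq_ltn_trans _ tt).
  apply: ler_pM; rewrite ?invr_ge0//.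
  by rewrite lef_pV2 ?posrE ?ltr0n ?(leq_ltn_trans _ tt)// ler_nat.
have vrec t : (t0 < t)%N -> v t.+1 <= (1 - kappa / t.+1%:R) * v t.
  move=> tt; have := recursion_affine (ltnW tt); rewrite -/C' /v.
  have t_gt0 : 0 < t%:R :> R by rewrite ltr0n (leq_ltn_trans _ tt).
  have T1 : t.+1%:R = t%:R + 1 :> R by rewrite -natr1.
  have T0 : 0 < t%:R + 1 :> R by lra.
  rewrite T1; set T := t%:R in t_gt0 T0 *; move=> H.
  suff : C' / (T + 1) ^+ 2 + B / (T + 1) <= (1 - kappa / (T + 1)) * (B / T) by lra.
  rewrite -subr_ge0 (_ : _ - _ =
    (B * (1 - kappa) * (T + 1) - C' * T) / (T * (T + 1) ^+ 2)).
    apply: divr_ge0; last by apply: mulr_ge0; [exact: ltW|exact: sqr_ge0].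
    have := ler_wpM2r (ltW t_gt0) BC.
    have : 0 <= B * (1 - kappa) by apply: mulr_ge0 => //; exact: ltW.
    lra.
  by field; rewrite !gt_eqF.
pose H : nat -> R := series (@harmonic R).
have HS t : H t.+1 = H t + t.+1%:R^-1 by rewrite /H /series/= big_nat_recr.
have Hmono : {homo H : n m / (n <= m)%N >-> n <= m}.
  apply: homo_leq => [x|x y z|t]; [exact: lexx|exact: le_trans|].
  by rewrite HS lerDl invr_ge0.
have Hunb A : exists t, A < H t.
  apply: contrapT => /forallNP Hb; apply: (@dvg_harmonic R).
  apply: nondecreasing_is_cvgn => //; exists A => _ [t _ <-].
  by have /negP := Hb t; rewrite -leNgt.
(* [v t * g t] is nonincreasing since (1 - x)(g + x) <= g for [g >= 1], and [g] is unbounded. *)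
pose g t := 1 + kappa * (H t - H t0.+1).
have g1 t : (t0 < t)%N -> 1 <= g t.
  by move=> tt; rewrite /g lerDl mulr_ge0 ?subr_ge0 ?(ltW kappa_gt0)//; exact: Hmono.
have v_ge0 t : (t0 < t)%N -> 0 <= v t.
  by move=> tt; apply: le_trans (ev t tt); exact: e_ge0 (ltnW tt).
have vg t : (t0 < t)%N -> v t * g t <= v t0.+1.
  elim: t => // t IH; rewrite ltnS leq_eqVlt => /orP[/eqP <-|tt].
    by rewrite /g subrr mulr0 addr0 mulr1.
  apply: le_trans (IH tt).
  have -> : g t.+1 = g t + kappa / t.+1%:R by rewrite /g HS; ring.
  set x := kappa / t.+1%:R; have x0 : 0 <= x by rewrite divr_ge0 ?ltW.
  have gt := g1 t tt; have vt := v_ge0 t tt.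
  apply: (@le_trans _ _ ((1 - x) * v t * (g t + x))).
    by apply: ler_wpM2r; [lra|exact: vrec].
  rewrite -subr_ge0 (_ : _ - _ = v t * (x * (g t - 1) + x ^+ 2)); last by ring.
  by rewrite mulr_ge0// addr_ge0 ?sqr_ge0// mulr_ge0//; lra.
have [t1 Ht1] := Hunb (H t0.+1 + (v t0.+1 / r) / kappa).
exists (maxn t1 t0.+1) => t; rewrite geq_max => /andP[tt1 tt].
apply: (le_trans (ev t tt)); have gpos : 0 < g t by exact: lt_le_trans (g1 t tt).
have : v t0.+1 / r <= g t.
  have : (v t0.+1 / r) / kappa <= H t - H t0.+1 by have := Hmono _ _ tt1; lra.
  by rewrite ler_pdivrMr// /g; lra.
rewrite ler_pdivrMr// => G; have := vg t tt => V.
have : v t * g t <= g t * r by exact: le_trans V G.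
by rewrite mulrC ler_pM2l.
Qed.

End Recursion.

Lemma expectation_finite (R : realType) (dsp : measure_display) (T : measurableType dsp)
    (P : probability T R) (A : finType) (X : T -> A) (phi : A -> R) :
  (forall a, measurable [set w | X w = a]) -> (forall a, 0 <= phi a) ->
  ('E_P[fun w => phi (X w)] = (\sum_a phi a * fine (P [set w | X w = a]))%:E)%E.
Proof.
move=> mX phi0; rewrite unlock.
have mI a : measurable_fun setT (fun w => (\1_[set w | X w = a] w)%:E : \bar R).
  by apply/measurable_EFinP; exact: measurable_indic.
transitivity (\int[P]_w \sum_a ((phi a)%:E * (\1_[set w | X w = a] w)%:E))%E.
  apply: eq_integral => w _.
  rewrite (bigD1 (X w))//= indicE mem_set// mule1 big1 ?adde0//.
  move=> a aX; rewrite indicE memNset ?mule0//=.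
  by move=> Xa; rewrite Xa eqxx in aX.
rewrite ge0_integral_sum//; last 2 first.
- by move=> a; exact: measurable_funeM.
- by move=> a w _; rewrite mule_ge0 ?lee_fin.
rewrite -sumEFin; apply: eq_bigr => a _.
rewrite ge0_integralZl ?lee_fin//.
rewrite integral_indic// setIT EFinM fineK//.
exact: fin_num_measure.
Qed.

(** * Law of the finite history *)

Section History.
Context {R : realType} {dsp : measure_display} {T : measurableType dsp}
  (P : probability T R) {N h : nat} (E : 'I_h -> rel 'I_N) (Pm : 'M[R]_h)
  (m : nat -> T -> 'I_h) (c : 'I_N -> 'I_N -> R) (sigma : R)
  (dn : nat -> 'I_N -> 'I_N -> T -> R) (M beta gamma : R) (t0 : nat).
Context (y0 : 'I_N -> R) (z0 : pairT E -> R).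
Context (Y : nat -> 'I_N -> T -> R) (Z : nat -> pairT E -> T -> R).

Local Notation bits := {ffun pairT E -> bool}.
Local Notation uz := (upd_z c sigma M beta).
Local Notation uy := (upd_y c sigma M beta gamma).

Definition noise t (p : pairT E) : T -> R := dn t (val p).1 (val p).2.

Definition obs t w : bits := [ffun p : pairT E => Y t (val p).2 w + noise t p w <= thr c p].

Hypothesis markov : markov_chain P m Pm.
Hypothesis noise_meas : forall t p, measurable_fun setT (noise t p).
Hypothesis noise_law : forall t p (B : set R), measurable B ->
  P (noise t p @^-1` B) = normal_prob 0 sigma B.
Hypothesis indep : mutually_independent P
    [set o | match o with None => True
             | Some (t, i, j) => nbr E i j end]
    (fun o => match o with
     | None => [set A | exists t s, A = cyl m t s]
     | Some (t, i, j) => [set A | exists B : set R, measurable B /\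
                                   A = dn t i j @^-1` B] end).
Hypothesis Y_init : forall i w, Y t0.+1 i w = y0 i.
Hypothesis Z_init : forall p w, Z t0 p w = z0 p.
Hypothesis Z_rec : forall t p w, (t0 <= t)%N ->
  Z t.+1 p w = uz t.+1 (m t.+1 w) (obs t.+1 w) (fun p => Z t p w) p.
Hypothesis Y_rec : forall t i w, (t0 <= t)%N ->
  Y t.+2 i w =
  uy t.+1 (m t.+1 w) (obs t.+1 w) (fun i => Y t.+1 i w) (fun p => Z t p w) i.

(* The modes up to time [t0 + k] and the observed bits at times [t0 + 1, ..., t0 + k]. *)
Fixpoint Hist (k : nat) : finType :=
  if k is k'.+1 then (Hist k' * ('I_h * bits))%type : finType
  else {ffun 'I_t0.+1 -> 'I_h} : finType.

(** A total function of time, as [cyl] takes; values after time [t0 + k] are arbitrary. *)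
Fixpoint hmode (k : nat) : Hist k -> nat -> 'I_h :=
  match k with
  | 0%N => fun a t => a (inord t)
  | k'.+1 => fun a t => if t == (t0 + k').+1 then a.2.1 else hmode a.1 t
  end.

Fixpoint hstate (k : nat) : Hist k -> ('I_N -> R) * (pairT E -> R) :=
  match k with
  | 0%N => fun _ => (y0, z0)
  | k'.+1 => fun a => let yz := hstate a.1 in
     (uy (t0 + k').+1 a.2.1 a.2.2 yz.1 yz.2, uz (t0 + k').+1 a.2.1 a.2.2 yz.2)
  end.

Fixpoint hist (k : nat) (w : T) : Hist k :=
  match k with
  | 0%N => [ffun i : 'I_t0.+1 => m i w]
  | k'.+1 => (hist k' w, (m (t0 + k').+1 w, obs (t0 + k').+1 w))
  end.

Fixpoint noise_weight (k : nat) : Hist k -> R :=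
  match k with
  | 0%N => fun _ => 1
  | k'.+1 => fun a => noise_weight a.1 * bits_weight c sigma (hstate a.1).1 a.2.2
  end.

Definition bit_event (y : 'I_N -> R) (b : bool) (p : pairT E) : set R :=
  if b then `]-oo, thr c p - y (val p).2]%classic
  else ~` `]-oo, thr c p - y (val p).2]%classic.

(** Once the past history is fixed, [y] is a constant, so each observed bit confines a single noise
    variable to a half-line or its complement. A history thus becomes an intersection of independent
    events. *)
Fixpoint noise_set (k : nat) : Hist k -> nat -> pairT E -> set R :=
  match k with
  | 0%N => fun _ _ _ => setT
  | k'.+1 => fun a t p => if t == (t0 + k').+1 then bit_event (hstate a.1).1 (a.2.2 p) p
                          else noise_set a.1 t p
  end.

Fixpoint noise_index (k : nat) : seq (nat * pairT E) :=
  if k is k'.+1 then noise_index k' ++ [seq ((t0 + k').+1, p) | p <- enum {: pairT E}]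
  else [::].

Lemma hist_state k w :
  hstate (hist k w) = (fun i => Y (t0 + k).+1 i w, fun p => Z (t0 + k) p w).
Proof.
elim: k => [|k IH] /=.
  by rewrite addn0; congr pair; apply/funext => ?; rewrite ?Y_init ?Z_init.
rewrite IH/= addnS; congr pair; apply/funext => ?; rewrite ?Y_rec ?Z_rec ?leq_addr//.
Qed.

Lemma mem_noise_index k x : x \in noise_index k -> (t0 < x.1 <= t0 + k)%N.
Proof.
elim: k => [//|k IH] /=; rewrite mem_cat => /orP[/IH /andP[-> H]|/mapP[p _ ->]/=].
  by rewrite (leq_trans H)// leq_add2l.
by rewrite ltnS leq_addr addnS leqnn.
Qed.

Lemma noise_index_uniq k : uniq (noise_index k).
Proof.
elim: k => [//|k IH] /=; rewrite cat_uniq IH/= map_inj_uniq ?enum_uniq ?andbT; last first.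
  by move=> p q [].
apply/hasPn => x /mapP[p _ ->]; apply/negP => /mem_noise_index /= /andP[_].
by rewrite ltnn.
Qed.

Lemma noise_set_measurable k (a : Hist k) t p : measurable (noise_set a t p).
Proof.
elim: k a => [|k IH] a /=; first exact: measurableT.
case: ifP => _ //; rewrite /bit_event; case: ifP => _; first exact: measurable_itv.
by apply: measurableC; exact: measurable_itv.
Qed.

Lemma noise_set_prob k (a : Hist k) :
  (\prod_(x <- noise_index k) P (noise x.1 x.2 @^-1` noise_set a x.1 x.2))%E =
  (noise_weight a)%:E.
Proof.
elim: k a => [|k IH] a; first by rewrite big_nil.
rewrite [noise_index _]/= big_cat/= EFinM; congr (_ * _)%E.
  rewrite -IH; apply: eq_big_seq => x /mem_noise_index /andP[_ xk].
  by rewrite ltn_eqF// ltnS.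
rewrite big_map big_enum/= /bits_weight -prodEFin; apply: eq_bigr => p _.
rewrite eqxx /bit_event /bit_weight noise_law; last first.
  by case: (a.2.2 p); [|apply: measurableC]; exact: measurable_itv.
case: (a.2.2 p); first by rewrite Fn_EFin.
have := @probability_setC _ _ _ (normal_prob 0 sigma : probability _ R)
  `]-oo, thr c p - (hstate a.1).1 (val p).2]%classic (measurable_itv _).
by move=> ->; rewrite EFinB Fn_EFin.
Qed.

Definition hist_event k (a : Hist k) : set T :=
  cyl m (t0 + k) (hmode a) `&`
  \big[setI/setT]_(x <- noise_index k) (noise x.1 x.2 @^-1` noise_set a x.1 x.2).

Lemma hist_event_prob k (a : Hist k) :
  P (hist_event a) = (P (cyl m (t0 + k) (hmode a)) * (noise_weight a)%:E)%E.
Proof.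
pose ix (x : nat * pairT E) : option (nat * 'I_N * 'I_N) :=
  Some (x.1, (val x.2).1, (val x.2).2).
(* The independence hypothesis ranges over all triples of indices; [setT] fills those whose pair
   lies outside the union graph, and [noise_index] never reaches them. *)
pose A (o : option (nat * 'I_N * 'I_N)) : set T :=
  match o with
  | None => cyl m (t0 + k) (hmode a)
  | Some (t, i, j) => if insub (i, j) is Some p then noise t p @^-1` noise_set a t p
                      else setT
  end.
have Aix x : A (ix x) = noise x.1 x.2 @^-1` noise_set a x.1 x.2.
  by rewrite /A /ix -surjective_pairing valK.
have ix_inj : injective ix.
  move=> [t p] [t' p'] [-> e1 e2]; congr pair; apply: val_inj.
  by rewrite [LHS]surjective_pairing e1 e2 -surjective_pairing.
have := indep (s := None :: map ix (noise_index k)) (A := A).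
rewrite !big_cons !big_map; under eq_bigr do rewrite Aix.
under [in X in _ = X]eq_bigr do rewrite Aix.
rewrite noise_set_prob; apply.
  rewrite /= map_inj_uniq// noise_index_uniq andbT.
  by apply/mapP => -[].
move=> o; rewrite inE => /orP[/eqP ->|/mapP[[t p] _ ->]]; split => //=.
- by exists (t0 + k)%N, (hmode a).
- exact: valP p.
- exists (noise_set a t p); split; first exact: noise_set_measurable.
  by rewrite -surjective_pairing valK.
Qed.

Lemma cyl_measurable t s : measurable (cyl m t s).
Proof.
rewrite (_ : cyl m t s = \big[setI/setT]_(k <- iota 0 t.+1) [set w | m k w = s k]).
  by apply: bigsetI_measurable => k _; case: markov.
rewrite -bigcap_seq; apply/seteqP; split => w H k.
  by rewrite /mkset mem_iota => /andP[_ kt]; exact: H.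
by move=> kt; apply: H; rewrite /mkset mem_iota.
Qed.

Lemma hist_event_measurable k (a : Hist k) : measurable (hist_event a).
Proof.
apply: measurableI; first exact: cyl_measurable.
apply: bigsetI_measurable => x _; rewrite -[X in measurable X]setTI.
by apply: noise_meas => //; exact: noise_set_measurable.
Qed.

Lemma cyl_hmode k (a : Hist k.+1) :
  cyl m (t0 + k.+1) (hmode a) =
  cyl m (t0 + k) (hmode a.1) `&` [set w | m (t0 + k).+1 w = a.2.1].
Proof.
rewrite addnS; apply/seteqP; split => [w H|w [H1 H2]] /=.
  split; last by have := H _ (leqnn _); rewrite /= eqxx.
  by move=> j jk; have := H j (leqW jk); rewrite /= ltn_eqF.
move=> j; rewrite leq_eqVlt => /orP[/eqP ->|]; first by rewrite eqxx.
by rewrite ltnS => jk; rewrite ltn_eqF ?ltnS//; exact: H1.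
Qed.

Lemma hist_eventE k (a : Hist k) : [set w | hist k w = a] = hist_event a.
Proof.
elim: k a => [|k IH] a.
  rewrite /hist_event big_nil setIT addn0; apply/seteqP; split => w /=.
    by move=> <- j jt; rewrite ffunE inordK.
  by move=> H; apply/ffunP => j; rewrite ffunE H ?inord_val// -ltnS.
have split_hist : [set w | hist k.+1 w = a] =
   [set w | hist k w = a.1] `&` ([set w | m (t0 + k).+1 w = a.2.1] `&`
   [set w | obs (t0 + k).+1 w = a.2.2]).
  by apply/seteqP; split => w /=; [move=> <-|case: a => a [u s] [/= -> [-> ->]]].
rewrite split_hist /hist_event cyl_hmode [noise_index _]/= big_cat/=.
have -> : \big[setI/setT]_(x <- noise_index k)
     (noise x.1 x.2 @^-1` noise_set a x.1 x.2) =
   \big[setI/setT]_(x <- noise_index k) (noise x.1 x.2 @^-1` noise_set a.1 x.1 x.2).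
  by apply: eq_big_seq => x /mem_noise_index /andP[_ xk]; rewrite /= ltn_eqF// ltnS.
set C1 := cyl m _ _; set B1 := \big[setI/setT]_(x <- noise_index k) _.
set C2 := [set w | m _ w = _]; set B2 := \big[setI/setT]_(x <- map _ _) _.
have := IH a.1; rewrite /hist_event -/C1 -/B1 => HI.
rewrite setIACA -HI.
apply/seteqP; split => w [/= hw [mw ow]]; split=> //; split => //.
  rewrite /B2 -bigcap_seq => -[t p] /= /mapP[p' _ [-> ->]].
  rewrite eqxx /bit_event -hw hist_state/= -ow ffunE.
  case: ifP; rewrite /= in_itv/= => H; first lra.
  by apply/negP; rewrite -ltNge; move/negbT: H; rewrite -ltNge; lra.
move: ow; rewrite /B2 -bigcap_seq => ow; apply/ffunP => p; rewrite ffunE.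
have := ow ((t0 + k).+1, p); rewrite /= eqxx /bit_event -hw hist_state/= => H.
have {}H := H (map_f _ (mem_enum _ p)).
move: H; case: (a.2.2 p); rewrite /= in_itv/= => H.
  by lra.
by apply/negP => H'; apply: H; lra.
Qed.

Definition hist_weight k (a : Hist k) : R := fine (P [set w | hist k w = a]).

Definition hlast k (a : Hist k) : 'I_h := hmode a (t0 + k).

(** The product formula for histories gains one transition probability and one row of bits: this is
    the Markov property of the joint chain. *)
Lemma hist_weightS k (a : Hist k.+1) : hist_weight a =
  hist_weight a.1 * (Pm (hlast a.1) a.2.1 * bits_weight c sigma (hstate a.1).1 a.2.2).
Proof.
rewrite /hist_weight !hist_eventE !hist_event_prob cyl_hmode.
case: markov => _ ->.
have fC := fin_num_measure P _ (cyl_measurable (t0 + k) (hmode a.1)).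
rewrite -(fineK fC) -!EFinM/= /hlast; ring.
Qed.

Lemma hist_weight_ge0 k (a : Hist k) : 0 <= hist_weight a.
Proof. exact: fine_ge0. Qed.

(** Expectation as a finite sum, so linearity and monotonicity hold for functions of any sign. *)
Definition Ex k (phi : Hist k -> R) : R := \sum_a phi a * hist_weight a.

Lemma Ex_le k (phi psi : Hist k -> R) : (forall a, phi a <= psi a) -> Ex phi <= Ex psi.
Proof. by move=> H; apply: ler_sum => a _; rewrite ler_wpM2r ?hist_weight_ge0. Qed.

Lemma Ex_expectation k (phi : Hist k -> R) : (forall a, 0 <= phi a) ->
  ('E_P[fun w => phi (hist k w)] = (Ex phi)%:E)%E.
Proof.
move=> phi0; apply: expectation_finite => // a.
by rewrite hist_eventE; exact: hist_event_measurable.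
Qed.

Lemma Ex_cst k (r : R) : Ex (fun _ : Hist k => r) = r.
Proof.
have E1 : Ex (fun _ : Hist k => 1) = 1.
  by apply: EFin_inj; rewrite -Ex_expectation// (expectation_cst P 1).
by rewrite -[RHS]mulr1 -E1 /Ex mulr_sumr; apply: eq_bigr => a _; rewrite mul1r.
Qed.

Lemma Ex_D k (phi psi : Hist k -> R) : Ex (fun a => phi a + psi a) = Ex phi + Ex psi.
Proof. by rewrite -big_split/=; apply: eq_bigr => a _; rewrite mulrDl. Qed.

Lemma Ex_Z k r (phi : Hist k -> R) : Ex (fun a => r * phi a) = r * Ex phi.
Proof. by rewrite mulr_sumr; apply: eq_bigr => a _; rewrite mulrA. Qed.

Lemma Ex_step k (phi : 'I_h -> ('I_N -> R) -> (pairT E -> R) -> R) :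
  Ex (fun a : Hist k.+1 => phi (hlast a) (hstate a).1 (hstate a).2) =
  Ex (fun a : Hist k => Tstep c sigma M beta gamma Pm (t0 + k).+1 phi (hlast a)
                          (hstate a).1 (hstate a).2).
Proof.
rewrite /Ex; under eq_bigr do rewrite hist_weightS.
rewrite -(pair_bigA _ (fun (a : Hist k) (us : 'I_h * bits) =>
   phi (hlast ((a, us) : Hist k.+1)) (hstate ((a, us) : Hist k.+1)).1
       (hstate ((a, us) : Hist k.+1)).2 *
   (hist_weight a * (Pm (hlast a) us.1 * bits_weight c sigma (hstate a).1 us.2))))/=.
apply: eq_bigr => a _; rewrite /Tstep mulr_suml.
rewrite -(pair_bigA _ (fun (u : 'I_h) (s : bits) =>
   phi (hlast ((a, (u, s)) : Hist k.+1)) (hstate ((a, (u, s)) : Hist k.+1)).1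
       (hstate ((a, (u, s)) : Hist k.+1)).2 *
   (hist_weight a * (Pm (hlast a) u * bits_weight c sigma (hstate a).1 s))))/=.
apply: eq_bigr => u _; rewrite mulr_sumr mulr_suml; apply: eq_bigr => s _.
by rewrite {1}/hlast/= addnS eqxx; ring.
Qed.

Lemma hstate_box k (a : Hist k) : 0 < M -> 0 < gamma ->
  gamma * (dmax' E)%:R <= t0.+1%:R -> in_box M y0 z0 ->
  in_box M (hstate a).1 (hstate a).2.
Proof.
move=> M0 g0 gd box0; elim: k a => [//|k IH] a /=; apply: upd_box => //.
by apply: (le_trans gd); rewrite ler_nat ltnS; lia.
Qed.

End History.

Lemma sqrrD_le (F : realFieldType) (a b : F) : (a + b) ^+ 2 <= 2 * a ^+ 2 + 2 * b ^+ 2.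
Proof. by have := sqr_ge0 (a - b); lra. Qed.

Lemma cvge0_of_eventually_le (R : realType) (u : nat -> \bar R) :
  (forall t, (0 <= u t)%E) ->
  (forall r : R, 0 < r -> exists t1, forall t, (t1 <= t)%N -> (u t <= r%:E)%E) ->
  u t @[t --> \oo] --> 0%E.
Proof.
move=> u0 ur.
have ufin t r : (u t <= r%:E)%E -> u t \is a fin_num.
  by move=> utr; rewrite ge0_fin_numE//; exact: le_lt_trans utr (ltry _).
apply/fine_cvgP; split.
  have [t1 H] := ur 1 ltr01; exists t1 => // t /= tt; exact: ufin (H t tt).
apply/cvgrPdist_le => r r0; have [t1 H] := ur r r0; exists t1 => // t /= tt.
rewrite sub0r normrN ger0_norm ?fine_ge0// -lee_fin fineK ?H//; exact: ufin (H t tt).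
Qed.

(** * Closed loop under the gains [K1] and [K2] *)

Section Gains.
Context {R : realType}.

(** Multiplication by the companion matrix shifts the entries of [K2] by one place and adds the row
    of the [a k], since the last entry of [K2] is 1. *)
Lemma gain_companion n (a b : nat -> R) : (2 <= n)%N ->
  gainK2 n b *m companionA n a = gainK2 n b - gainK1 n a b.
Proof.
case: n => [|[|n]] // _; apply/rowP => k.
rewrite mxE big_ord_recr/= !mxE/= !eqxx mul1r.
have -> : \sum_(i < n.+1) gainK2 n.+2 b 0 (widen_ord (leqnSn n.+1) i) *
    companionA n.+2 a (widen_ord (leqnSn n.+1) i) k = if (k : nat) == 0%N then 0 else b k.
  have [k0|k0] := eqVneq (k : nat) 0%N.
    apply: big1 => i _; rewrite !mxE/= [_ == n.+1]ltn_eqF// k0/= mulr0//.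
  have kn : (k.-1 < n.+1)%N by have := ltn_ord k; lia.
  rewrite (bigD1 (Ordinal kn))//= big1 ?addr0.
    rewrite !mxE/= [_ == n.+1]ltn_eqF// prednK ?lt0n// eqxx mulr1//.
  move=> i /eqP ik; rewrite !mxE/= [_ == n.+1]ltn_eqF//.
  have -> : ((k : nat) == i.+1) = false.
    by apply/eqP => ki; apply: ik; apply: val_inj => /=; rewrite ki.
  by rewrite mulr0.
rewrite eqSS; have [->|k0] := eqVneq (k : nat) 0%N; first by rewrite /=; ring.
rewrite eqSS; have [->|kn] := eqVneq (k : nat) n.+1; first by rewrite /=; ring.
by rewrite /=; ring.
Qed.

Lemma gain_input n (b : nat -> R) : (2 <= n)%N -> sc (gainK2 n b) (vecB n) = 1.
Proof.
case: n => [|[|n]] // _; rewrite /sc mxE big_ord_recr/= !mxE/= eqxx mulr1 big1 ?add0r//.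
by move=> i _; rewrite !mxE/= [_ == n.+1]ltn_eqF// mulr0.
Qed.

Lemma gain_closed_loop n (a b : nat -> R) (x : 'cV[R]_n) (v : R) : (2 <= n)%N ->
  sc (gainK2 n b) (companionA n a *m x + (sc (gainK1 n a b) x + v) *: vecB n) =
  sc (gainK2 n b) x + v.
Proof.
move=> n2; have := gain_input b n2; rewrite /sc mulmxDr mulmxA gain_companion// mulmxBl.
rewrite -scalemxAr => B1; rewrite !mxE; rewrite mxE in B1; rewrite B1.
ring.
Qed.

End Gains.

(** * Mean square errors along the process *)

Section MeanSquare.
Context {R : realType} {dsp : measure_display} {T : measurableType dsp}
  (P : probability T R) {N h : nat} (E : 'I_h -> rel 'I_N) (Pm : 'M[R]_h)
  (pi : 'I_h -> R)
  (m : nat -> T -> 'I_h) (c : 'I_N -> 'I_N -> R) (sigma : R)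
  (dn : nat -> 'I_N -> 'I_N -> T -> R) (M beta gamma : R) (t0 : nat).
Context (y0 : 'I_N -> R) (z0 : pairT E -> R).
Context (Y : nat -> 'I_N -> T -> R) (Z : nat -> pairT E -> T -> R).
Local Notation uz := (upd_z c sigma M beta).
Local Notation uy := (upd_y c sigma M beta gamma).

Hypothesis N2 : (2 <= N)%N.
Hypothesis simpleE : forall u, undirected_simple N (E u).
Hypotheses (stoch : stochastic Pm) (irr : irreducible Pm) (stat : stationary Pm pi).
Hypothesis markov : markov_chain P m Pm.
Hypotheses (sigma_gt0 : 0 < sigma) (M_gt0 : 0 < M).
Hypotheses (beta_gt0 : 0 < beta) (gamma_gt0 : 0 < gamma).
Hypothesis noise_meas : forall t (p : pairT E), measurable_fun setT (noise dn t p).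
Hypothesis noise_law : forall t (p : pairT E) (B : set R), measurable B ->
  P (noise dn t p @^-1` B) = normal_prob 0 sigma B.
Hypothesis indep : mutually_independent P
    [set o | match o with None => True
             | Some (t, i, j) => nbr E i j end]
    (fun o => match o with
     | None => [set A | exists t s, A = cyl m t s]
     | Some (t, i, j) => [set A | exists B : set R, measurable B /\
                                   A = dn t i j @^-1` B] end).
Hypothesis Y_init : forall i w, Y t0.+1 i w = y0 i.
Hypothesis Z_init : forall p w, Z t0 p w = z0 p.
Hypothesis Z_rec : forall t p w, (t0 <= t)%N ->
  Z t.+1 p w = uz t.+1 (m t.+1 w) (obs E c dn Y t.+1 w) (fun p => Z t p w) p.
Hypothesis Y_rec : forall t i w, (t0 <= t)%N ->
  Y t.+2 i w =
  uy t.+1 (m t.+1 w) (obs E c dn Y t.+1 w) (fun i => Y t.+1 i w) (fun p => Z t p w) i.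
Hypothesis t0_large : gamma * (dmax' E)%:R <= t0.+1%:R.
Hypothesis box0 : in_box M y0 z0.

Context (lam2 : R).
Hypotheses (lam2_gt0 : 0 < lam2) (lG_gt0 : 0 < lambdaG E :> R).
Hypothesis gap : forall y : 'I_N -> R, \sum_i y i = 0 ->
    2 * (lam2 * \sum_i y i ^+ 2) <=
    \sum_(p : pairT E) avg_edge pi p * (y (val p).1 - y (val p).2) ^+ 2.

Local Notation err1 i t := ('E_P[fun w => ((Y t i w - mean (fun i => Y t i w)) ^+ 2)%R])%E.
Local Notation err2 p t := ('E_P[fun w => ((Z t p w - Y t (val p).2 w) ^+ 2)%R])%E.

(** The indicator on the right is averaged over the next mode, the one that selects the graph of the
    step. By stationarity its [pi]-mean is still [avg_edge], so the source has mean 0. *)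
Lemma poisson_corrector : exists psi : pairT E -> 'I_h -> R, forall p u,
  psi p u - \sum_v Pm u v * psi p v = avg_edge pi p - \sum_v Pm u v * edge v p.
Proof.
have H (p : pairT E) : exists g : 'I_h -> R, forall u,
    g u - \sum_v Pm u v * g v = avg_edge pi p - \sum_v Pm u v * edge v p.
  apply: (poisson_solution stoch irr stat); case: stat => _ pi1 piP.
  under eq_bigr do rewrite mulrBr.
  rewrite sumrB -mulr_suml pi1 mul1r; apply/eqP; rewrite subr_eq0; apply/eqP.
  rewrite /avg_edge; under [RHS]eq_bigr do rewrite mulr_sumr.
  rewrite exchange_big/=; apply: eq_bigr => v _; rewrite -[in LHS]piP mulr_suml.
  by apply: eq_bigr => u _; rewrite mulrA.
by have [psi psiP] := boolp.choice H; exists psi.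
Qed.

(** [e t] is the expectation of V + q W at the state y(t+1), zh(t). The error of zh(t+1) against
    y(t+1) is therefore bounded through [e t.+1] and the move of [y] from t+1 to t+2. *)
Lemma mean_square_bounds (kappa q : R) : 0 < kappa -> 0 < q ->
  kappa + q * (gamma * lambdaG E / lam2) <= gamma * lam2 ->
  q * kappa + gamma * lambdaG E / lam2 <=
    q * (2 * beta * fM E sigma M c * pi_min pi - gamma * alphaC E lam2) ->
  exists (e : nat -> R) (B : R),
   [/\ 0 <= B,
       forall i t, (t0 <= t)%N -> (err1 i t.+1 <= (e t)%:E)%E,
       forall p t, (t0 <= t)%N -> (err2 p t.+1 <= (B * e t.+1 + B / t.+1%:R ^+ 2)%:E)%E,
       kappa <= 2^-1 -> forall r, 0 < r -> exists t1, forall t, (t1 <= t)%N -> e t <= r &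
       1 < kappa -> kappa <= 2 ->
         exists2 K, 0 < K & forall t, (t0 <= t)%N -> e t <= K / t.+1%:R].
Proof.
move=> kappa_gt0 q_gt0 k1 k2.
have pi_gt0 := stationary_gt0 stoch irr stat.
have [psi psiP] := poisson_corrector.
have [C C0 HC] := lyap_drift sigma_gt0 M_gt0 N2 beta_gt0 gamma_gt0 simpleE stoch q_gt0
  lam2_gt0 lG_gt0 gap pi_gt0 psiP k1 k2.
have [D D0 HD] := corrector_bound c sigma_gt0 M_gt0 beta_gt0 gamma_gt0 q_gt0 psi.
have [C1 C10 close] := upd_y_close E c sigma beta M_gt0 gamma_gt0.
pose st k := @hstate R N h E c sigma M beta gamma t0 y0 z0 k.
pose ex k := @Ex R dsp T P N h E m c dn t0 Y k.
pose S (yz : ('I_N -> R) * (pairT E -> R)) := disagr yz.1 + q * esterr yz.1 yz.2.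
have S0 yz : 0 <= S yz.
  rewrite addr_ge0// ?mulr_ge0 ?(ltW q_gt0)//; apply: sumr_ge0 => ? _; exact: sqr_ge0.
pose ek k := ex k (fun a => S (st k a)).
pose wk k := ex k (fun a => lyap c sigma M beta gamma q psi (t0 + k) (hlast a)
                              (st k a).1 (st k a).2).
have boxk k a : in_box M (st k a).1 (st k a).2 by exact: hstate_box.
have ExM k (f g : Hist E t0 k -> R) : (forall a, f a <= g a) -> ex k f <= ex k g by exact: Ex_le.
have ExC k r : ex k (fun=> r) = r.
  exact: (Ex_cst markov noise_meas Y_init Z_init Z_rec Y_rec).
have ek_wk k : ek k <= wk k + D / (t0 + k).+1%:R.
  rewrite -[D / _](ExC k) -[_ + _]Ex_D; apply: ExM => a.
  have := HD (hlast a) _ _ (boxk k a); rewrite ler_norml => /andP[H _].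
  rewrite /lyap /S -addrA lerDl; set T' := (t0 + k).+1%:R.
  by rewrite mulrC -mulrDl mulr_ge0// ?invr_ge0//; lra.
have wk_ek k : wk k <= ek k + D / (t0 + k).+1%:R.
  rewrite -[D / _](ExC k) -[_ + _]Ex_D; apply: ExM => a.
  have := HD (hlast a) _ _ (boxk k a); rewrite ler_norml => /andP[_ H].
  by rewrite /lyap /S lerD2l mulrC ler_wpM2r ?invr_ge0.
have wk_rec k : wk k.+1 <=
    wk k - kappa / (t0 + k).+1%:R * ek k + C / (t0 + k).+1%:R ^+ 2.
  rewrite /wk addnS /ex /st.
  rewrite (Ex_step markov noise_law indep Y_init Z_init Z_rec Y_rec k
    (lyap c sigma M beta gamma q psi (t0 + k).+1)).
  rewrite -/(ex k) -/(st k) /ek -[C / _](ExC k) -mulNr -[_ * ex k _]Ex_Z -!Ex_D; apply: ExM => a.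
  rewrite mulNr; apply: HC; last exact: boxk.
  by apply: (le_trans t0_large); rewrite ler_nat ltnS leqW// leq_addr.
pose e t := ek (t - t0)%N; pose w t := wk (t - t0)%N.
have e0 t : (t0 <= t)%N -> 0 <= e t.
  by move=> _; rewrite -[0](ExC (t - t0)%N); apply: ExM => a.
have e_w t : (t0 <= t)%N -> e t <= w t + D / t.+1%:R.
  by move=> tt; have := ek_wk (t - t0)%N; rewrite subnKC.
have w_e t : (t0 <= t)%N -> w t <= e t + D / t.+1%:R.
  by move=> tt; have := wk_ek (t - t0)%N; rewrite subnKC.
have w_rec t : (t0 <= t)%N -> w t.+1 <= w t - kappa / t.+1%:R * e t + C / t.+1%:R ^+ 2.
  by move=> tt; have := wk_rec (t - t0)%N; rewrite subnKC// /w subSn.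
have ExE k (phi : Hist E t0 k -> R) : (forall a, 0 <= phi a) ->
    ('E_P[fun w => phi (hist E m c dn t0 Y k w)] = (ex k phi)%:E)%E.
  exact: (Ex_expectation markov noise_meas Y_init Z_init Z_rec Y_rec).
have stE k v : st k (hist E m c dn t0 Y k v) =
    (fun i => Y (t0 + k).+1 i v, fun p => Z (t0 + k) p v).
  exact: hist_state.
(* From (eps + d)^2 <= 2 eps^2 + 2 d^2, where eps^2 is at most (V + q W)/q and the move [d] of [y]
   is at most C1/t. *)
exists e, (2 / q + 2 * (C1 * C1)); split.
- by rewrite addr_ge0 ?mulr_ge0 ?invr_ge0// ltW.
- move=> i t tt; have [k kE] : exists k, t = (t0 + k)%N by exists (t - t0)%N; rewrite subnKC.
  have -> : e t = ek k by rewrite /e kE addKn.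
  rewrite kE.
  have -> : (fun w => (Y (t0 + k).+1 i w - mean (fun i => Y (t0 + k).+1 i w)) ^+ 2) =
      (fun w => dev (st k (hist E m c dn t0 Y k w)).1 i ^+ 2).
    by apply/funext => v; rewrite stE.
  rewrite (ExE k (fun a => dev (st k a).1 i ^+ 2)); last by move=> a; exact: sqr_ge0.
  rewrite lee_fin; apply: ExM => a; rewrite /S.
  apply: (@le_trans _ _ (disagr (st k a).1)).
    rewrite /disagr (bigD1 i)//= lerDl; apply: sumr_ge0 => j _; exact: sqr_ge0.
  rewrite lerDl mulr_ge0 ?(ltW q_gt0)//; apply: sumr_ge0 => j _; exact: sqr_ge0.
- move=> p t tt; have [k kE] : exists k, t = (t0 + k)%N by exists (t - t0)%N; rewrite subnKC.
  have -> : e t.+1 = ek k.+1 by rewrite /e kE -addnS addKn.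
  rewrite kE.
  (* Both times are visible in one history of length [k.+1]: the estimate in its state, the earlier
     [y] in the state of its prefix [a.1]. *)
  have -> : (fun w => (Z (t0 + k).+1 p w - Y (t0 + k).+1 (val p).2 w) ^+ 2) =
      (fun w => (fun a : Hist E t0 k.+1 =>
         ((st k.+1 a).2 p - (st k a.1).1 (val p).2) ^+ 2) (hist E m c dn t0 Y k.+1 w)).
    by apply/funext => v; rewrite stE [st k _]stE addnS.
  rewrite (ExE k.+1 (fun a => ((st k.+1 a).2 p - (st k a.1).1 (val p).2) ^+ 2)); last first.
    by move=> a; exact: sqr_ge0.
  set B := _ / _ + _; rewrite lee_fin -[B / _](ExC k.+1) -[B * ek k.+1]Ex_Z -Ex_D.
  apply: ExM => a.
  have T_gt0 : 0 < (t0 + k).+1%:R :> R by rewrite ltr0n.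
  have cl : `|(st k.+1 a).1 (val p).2 - (st k a.1).1 (val p).2| <= C1 / (t0 + k).+1%:R.
    by apply: close => //; exact: boxk.
  have eS : (2 / q) * S (st k.+1 a) >= 2 * eps (st k.+1 a).1 (st k.+1 a).2 p ^+ 2.
    apply: (@le_trans _ _ (2 / q * (q * esterr (st k.+1 a).1 (st k.+1 a).2))).
      rewrite (mulrA (2 / q)) divfK ?gt_eqF// ler_pM2l//.
      by rewrite /esterr (bigD1 p)//= lerDl; apply: sumr_ge0 => j _; exact: sqr_ge0.
    by rewrite ler_pM2l ?divr_gt0// /S lerDr; apply: sumr_ge0 => j _; exact: sqr_ge0.
  have S1 := S0 (st k.+1 a).
  have C11 : 0 <= 2 * (C1 * C1) by rewrite !mulr_ge0.
  have q2 : 0 <= 2 / q by rewrite divr_ge0// ltW.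
  set d := _ - _ in cl.
  have d2 : d ^+ 2 <= (C1 * C1) / (t0 + k).+1%:R ^+ 2.
    have := mulr_norm_le cl cl; rewrite -expr2 ger0_norm ?sqr_ge0// => H.
    by apply: (le_trans H); rewrite expr2 invfM mulrACA.
  move: T_gt0 cl d2; move: ((t0 + k).+1%:R) => T' T0 cl d2.
  rewrite (_ : (st k.+1 a).2 p - _ = eps (st k.+1 a).1 (st k.+1 a).2 p + d); last first.
    by rewrite /eps /d; ring.
  set ee := eps _ _ _ in eS *; set SS := S _ in eS S1 *.
  apply: (le_trans (sqrrD_le _ _)).
  apply: lerD; first by apply: (le_trans eS); rewrite ler_wpM2r// /B lerDl.
  have T2 : 0 <= (T' ^+ 2)^-1 by rewrite invr_ge0 sqr_ge0.
  apply: (@le_trans _ _ (2 * (C1 * C1) / T' ^+ 2)); first by rewrite -mulrA ler_pM2l.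
  by rewrite ler_wpM2r// /B lerDr.
- move=> kh; exact: (recursion_cvg C0 D0 kappa_gt0 e0 e_w w_e w_rec kh).
- move=> kh1 kh2; exact: (recursion_rate C0 D0 kappa_gt0 e0 e_w w_e w_rec kh1 kh2).
Qed.

End MeanSquare.

(** * From the gain thresholds to the two conclusions *)

Lemma inv_sqr_eventually_le (R : realType) (B r : R) : 0 <= B -> 0 < r ->
  exists t1, forall t, (t1 <= t)%N -> B / t.+1%:R ^+ 2 <= r.
Proof.
move=> B0 r0; exists (Num.bound (B / r)) => t tt.
have T1 : 1 <= t.+1%:R :> R by rewrite ler1n.
have BT : B <= r * t.+1%:R.
  rewrite mulrC -ler_pdivrMr//; apply: (le_trans (ltW (archi_boundP _))).
    by rewrite divr_ge0// ltW.
  by rewrite ler_nat (leq_trans tt).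
rewrite ler_pdivrMr ?exprn_gt0 ?ltr0n//; apply: (le_trans BT).
by rewrite ler_pM2l// expr2 ler_peMl// (le_trans ler01).
Qed.

Unset Implicit Arguments.
Set Strict Implicit.

Theorem theorem3
  (R : realType) (dsp : measure_display) (T : measurableType dsp)
  (P : probability T R)
  (* dimensions and plant *)
  (n N h : nat) (a b : nat -> R)
  (* graphs G_1..G_h *)
  (E : 'I_h -> rel 'I_N)
  (* Markov chain *)
  (Pm : 'M[R]_h) (pi : 'I_h -> R) (m : nat -> T -> 'I_h)
  (* eigenvalues lam 1 <= ... <= lam N of Lcheck *)
  (lam : nat -> R)
  (* communication *)
  (c : 'I_N -> 'I_N -> R) (sigma : R) (dn : nat -> 'I_N -> 'I_N -> T -> R)
  (* algorithm parameters and initial data *)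
  (beta gamma M : R) (t0 : nat)
  (x0 : 'I_N -> 'cV[R]_n) (z0 : 'I_N -> 'I_N -> R)
  (* the resulting processes: x_i(t) and zhat_ij(t) *)
  (x : nat -> 'I_N -> T -> 'cV[R]_n) (zh : nat -> 'I_N -> 'I_N -> T -> R) :
  (2 <= n)%N -> (2 <= N)%N ->
  (forall u, undirected_simple N (E u)) ->
  (forall i j, connect (nbr E) i j) ->
  stochastic Pm -> irreducible Pm -> aperiodic Pm -> stationary Pm pi ->
  markov_chain P m Pm ->
  (forall k l, (1 <= k)%N -> (k <= l)%N -> (l <= N)%N -> lam k <= lam l) ->
  char_poly (lapcheck E pi) = \prod_(1 <= k < N.+1) ('X - (lam k)%:P) ->
  0 < sigma ->
  (forall t i j, measurable_fun setT (dn t i j)) ->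
  (forall t i j, nbr E i j -> forall B : set R, measurable B ->
      P (dn t i j @^-1` B) = normal_prob 0 sigma B) ->
  (* the noises are i.i.d. and independent of the chain *)
  mutually_independent P
    [set o | match o with None => True
             | Some (t, i, j) => nbr E i j end]
    (fun o => match o with
     | None => [set A | exists t s, A = cyl m t s]
     | Some (t, i, j) => [set A | exists B : set R, measurable B /\
                                   A = dn t i j @^-1` B] end) ->
  0 < beta -> 0 < gamma -> (gamma * (dmax' E)%:R - 1 < t0%:R) ->
  0 < M ->
  (forall i, `|sc (gainK2 n b) (x0 i)| <= M) ->
  (forall i j, nbr E i j -> `|z0 i j| <= M) ->
  (* the algorithm *)
  (forall i w, x t0.+1 i w = x0 i) ->
  (forall i j w, nbr E i j -> zh t0 i j w = z0 i j) ->
  (forall t i j w, (t0 < t)%N -> nbr E i j ->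
     zh t i j w =
       PiM M (zh t.-1 i j w + beta / t%:R * (E (m t w) i j)%:R *
                (Fn sigma (c i j - zh t.-1 i j w)
                 - ((sc (gainK2 n b) (x t j w) + dn t i j w <= c i j)%R)%:R))) ->
  (forall t i w, (t0 < t)%N ->
     x t.+1 i w =
       let u := sc (gainK1 n a b) (x t i w)
                + gamma / (t.+1)%:R *
                  (\sum_(j < N | E (m t w) i j)
                     (zh t i j w - sc (gainK2 n b) (x t i w))) in
       companionA n a *m x t i w + u *: vecB n) ->
  let K2x i t w := sc (gainK2 n b) (x t i w) in
  let K2xbar t w := N%:R^-1 * \sum_(k < N) K2x k t w in
  let err1 i t := ('E_P[fun w => ((K2x i t w - K2xbar t w) ^+ 2)%R])%E in
  let err2 i j t := ('E_P[fun w => ((zh t i j w - K2x j t w) ^+ 2)%R])%E in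
  let lambda2 := lam 2%N in
  let lG := lambdaG E in
  let al := alphaC E lambda2 in
  let fm := fM E sigma M c in
  let pmin := pi_min pi in
  (* (i) *)
  (beta > (2 * fm * pmin)^-1 * (gamma * lG ^+ 2 / lambda2 ^+ 3 + gamma * al) ->
   forall i j, nbr E i j ->
     (err1 i t @[t --> \oo] --> 0%E) /\ (err2 i j t @[t --> \oo] --> 0%E))
  /\
  (* (ii) *)
  (gamma > lambda2^-1 ->
   beta > (2 * fm * pmin)^-1 *
            (gamma ^+ 2 * lG ^+ 2 / (lambda2 ^+ 2 * (gamma * lambda2 - 1))
             + gamma * al + 1) ->
   exists C : R, 0 < C /\
     forall i j t, nbr E i j -> (t0 < t)%N ->
       (err1 i t <= (C / t%:R)%:E)%E /\ (err2 i j t <= (C / t%:R)%:E)%E).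
Proof.
move=> n2 N2 simpleE conn stoch irr _ stat markov sorted_lam charL sigma_gt0 dn_meas
  dn_law indep beta_gt0 gamma_gt0 gd M_gt0 x0M z0M x_init z_init z_rec x_rec
  K2x K2xbar err1 err2 lambda2 lG al fm pmin.
have pi_gt0 := stationary_gt0 stoch irr stat.
have [lam2_gt0 gap] := laplacian_gap simpleE pi_gt0 N2 conn sorted_lam charL.
(* Two distinct connected nodes yield an edge, hence [lambdaG] is positive and can be divided by. *)
have p0 : pairT E.
  pose i0 : 'I_N := Ordinal (ltnW N2); pose i1 : 'I_N := Ordinal N2.
  have ex_nbr : exists p : 'I_N * 'I_N, nbr E p.1 p.2.
    have /connectP[[|k s] /=] := conn i0 i1; first by move=> _ /(congr1 val).
    by move=> /andP[ik _] _; exists (i0, k).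
  exact: (exist _ (xchoose ex_nbr) (xchooseP ex_nbr)).
have lG_gt0 : 0 < lambdaG E :> R := lambdaG_gt0 p0 N2.
have fm_gt0 : 0 < fm := fM_gt0 E M c sigma_gt0.
have pmin_gt0 : 0 < pmin := pi_min_gt0 pi_gt0.
pose Y t i w := K2x i t w.
pose Z t (p : pairT E) w := zh t (val p).1 (val p).2 w.
have noise_meas t (p : pairT E) : measurable_fun setT (noise dn t p) by exact: dn_meas.
have noise_law t (p : pairT E) (B : set R) : measurable B ->
    P (noise dn t p @^-1` B) = normal_prob 0 sigma B.
  by move=> mB; apply: dn_law mB; exact: valP p.
have Y_init i w : Y t0.+1 i w = sc (gainK2 n b) (x0 i) by rewrite /Y /K2x x_init.
have Z_init p w : Z t0 p w = z0 (val p).1 (val p).2.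
  by apply: z_init; exact: valP p.
have Z_rec t p w : (t0 <= t)%N -> Z t.+1 p w =
    upd_z c sigma M beta t.+1 (m t.+1 w) (obs E c dn Y t.+1 w) (fun p => Z t p w) p.
  by move=> tt; rewrite /Z z_rec ?ltnS//; [rewrite /upd_z ffunE|exact: valP p].
have Y_rec t i w : (t0 <= t)%N -> Y t.+2 i w =
    upd_y c sigma M beta gamma t.+1 (m t.+1 w) (obs E c dn Y t.+1 w)
      (fun i => Y t.+1 i w) (fun p => Z t p w) i.
  move=> tt; rewrite /Y /K2x x_rec ?ltnS// gain_closed_loop// /upd_y; congr (_ + _ * _).
  rewrite -(sum_Wmat E (m t.+1 w) i
    (fun j => zh t.+1 i j w - sc (gainK2 n b) (x t.+1 i w))).
  apply: eq_bigr => p _; rewrite -Z_rec// /Wmat /Z.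
  by have [<-//|_] := eqVneq (sval p).1 i; rewrite !mul0r.
have t0_large : gamma * (dmax' E)%:R <= t0.+1%:R.
  by apply: ltW; rewrite -natr1 -ltrBlDr.
have box0 : in_box M (fun i => sc (gainK2 n b) (x0 i))
    (fun p : pairT E => z0 (val p).1 (val p).2).
  by split=> [i|p]; [exact: x0M|apply: z0M; exact: valP p].
have main kappa q := mean_square_bounds N2 simpleE stoch irr stat markov sigma_gt0 M_gt0
  beta_gt0 gamma_gt0 noise_meas noise_law indep Y_init Z_init Z_rec Y_rec t0_large box0
  lam2_gt0 lG_gt0 gap (kappa := kappa) (q := q).
have err1_ge0 i t : (0 <= err1 i t)%E by apply: expectation_ge0 => w; exact: sqr_ge0.
have err2_ge0 i j t : (0 <= err2 i j t)%E by apply: expectation_ge0 => w; exact: sqr_ge0.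
pose bb := gamma * lambdaG E / lambda2.
have bb_gt0 : 0 < bb by rewrite /bb divr_gt0// mulr_gt0.
have fp_gt0 : 0 < 2 * fm * pmin by rewrite !mulr_gt0.
have dE : 2 * fm * pmin * beta = 2 * beta * fm * pmin by ring.
split=> [hbeta i j ij|hgamma hbeta].
  have [kappa [q [k0 k1 q0 w1 w2]]] : exists kappa q, [/\ 0 < kappa, kappa <= 0 + 2^-1,
      0 < q, kappa + q * bb <= gamma * lambda2 &
      q * kappa + bb <= q * (2 * beta * fm * pmin - gamma * al)].
    apply: choose_weights => //; first exact: mulr_gt0.
    move: hbeta; rewrite ltr_pdivrMl// dE -ltrBrDr => hbeta.
    (* With [k0 = 0], the hypothesis on [beta] is exactly b^2 < a d after multiplication by a =
       [gamma * lambda2]. *)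
    rewrite !subr0 (_ : bb ^+ 2 = gamma * lambda2 * (gamma * lG ^+ 2 / lambda2 ^+ 3)).
      by rewrite ltr_pM2l ?mulr_gt0.
    by rewrite /bb /lG; field; rewrite gt_eqF.
  rewrite add0r in k1.
  have [e [B [B0 e1 e2 e_cvg _]]] := main kappa q k0 q0 w1 w2.
  have {}e_cvg := e_cvg k1.
  split; apply: cvge0_of_eventually_le => // r r0.
    have [t1 H] := e_cvg r r0; exists (maxn t1 t0).+1 => -[//|t].
    rewrite ltnS geq_max => /andP[tt1 tt0]; apply: (le_trans (e1 i t tt0)).
    by rewrite lee_fin H.
  have r2 : 0 < r / 2 by rewrite divr_gt0.
  (* [B + 1] rather than [B], which is only known to be nonnegative. *)
  have rB : 0 < r / 2 / (B + 1) by rewrite divr_gt0// ltr_wpDl.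
  have [t1 H1] := e_cvg _ rB; have [t2 H2] := inv_sqr_eventually_le B0 r2.
  exists (maxn (maxn t1 t2) t0).+1 => -[//|t].
  rewrite ltnS !geq_max => /andP[/andP[tt1 tt2] tt0].
  apply: (le_trans (e2 (exist _ (i, j) ij : pairT E) t tt0)).
  rewrite lee_fin [r in _ <= r]splitr; apply: lerD; last exact: H2.
  apply: (@le_trans _ _ (B * (r / 2 / (B + 1)))).
    by apply: ler_wpM2l => //; apply: H1; exact: leqW.
  rewrite mulrCA ler_piMr ?(ltW r2)// ler_pdivrMr ?mul1r ?lerDl//.
  by rewrite ltr_wpDl.
have gl : 1 < gamma * lambda2 by rewrite -ltr_pdivrMr// div1r.
have gl1 : 0 < gamma * lambda2 - 1 by rewrite subr_gt0.
have [kappa [q [k0 k1 q0 w1 w2]]] : exists kappa q, [/\ 1 < kappa, kappa <= 1 + 2^-1,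
    0 < q, kappa + q * bb <= gamma * lambda2 &
    q * kappa + bb <= q * (2 * beta * fm * pmin - gamma * al)].
  apply: choose_weights => //.
  move: hbeta; rewrite ltr_pdivrMl// dE -ltrBrDr -ltrBrDr addrAC => hbeta.
  (* With [k0 = 1], the hypothesis on [beta] is exactly b^2 < (a - 1)(d - 1); the hypothesis on
     [gamma] is a > 1. *)
  rewrite (_ : bb ^+ 2 = (gamma * lambda2 - 1) *
     (gamma ^+ 2 * lG ^+ 2 / (lambda2 ^+ 2 * (gamma * lambda2 - 1)))).
    by rewrite ltr_pM2l.
  by rewrite /bb /lG; field; rewrite !gt_eqF.
have k2 : kappa <= 2 by clear - k1; lra.
have [e [B [B0 e1 e2 _ e_rate]]] := main kappa q (lt_trans ltr01 k0) q0 w1 w2.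
have [K K_gt0 eK] := e_rate k0 k2.
have BK : 0 <= B * K by rewrite mulr_ge0// ltW.
exists (K + (B * K + B)); split; first by rewrite ltr_pwDl// addr_ge0.
move=> i j [//|t] ij tt; have T_gt0 : 0 < t.+1%:R :> R by rewrite ltr0n.
split.
  apply: (le_trans (e1 i t tt)); rewrite lee_fin; apply: (le_trans (eK t tt)).
  by rewrite ler_pM2r ?invr_gt0// lerDl addr_ge0.
apply: (le_trans (e2 (exist _ (i, j) ij : pairT E) t tt)); rewrite lee_fin.
apply: (@le_trans _ _ ((B * K + B) / t.+1%:R)); last first.
  by rewrite ler_pM2r ?invr_gt0// lerDr ltW.
rewrite mulrDl; apply: lerD.
  rewrite -mulrA; apply: ler_wpM2l => //; apply: (le_trans (eK t.+1 (leqW tt))).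
  by rewrite ler_pM2l// lef_pV2 ?posrE ?ltr0n// ler_nat.
apply: ler_wpM2l => //; rewrite lef_pV2 ?posrE ?exprn_gt0//.
by rewrite expr2 ler_peMl// ?ler1n// ltW.
Qed.
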